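(* Let $M \models \mathbf{PA}^-$ and $n \geq 0$. The following are equivalent: 1. $M \models \mathbf{Coll}_{\mathrm{w}}^{\mathrm{d}}(\Sigma_{n+1})$. 2. $M \models \mathbf{Coll}_{\mathrm{w}}^-(\Sigma_{n+1})$. 3. $M$ satisfies the conditions $\mathsf{end}_{n}$ and $\mathsf{COF}_{n+2}^{\equiv}$. 4. $M$ satisfies the conditions $\mathsf{end}_{n}$ and $\mathsf{cof}_{n+2}^{\equiv}$.
   Context: $\mathcal{L}_A=\{0,1,+,\times,<\}$ is the language of first-order arithmetic, and $\mathbf{PA}^-$ is the $\mathcal{L}_A$-theory of the non-negative parts of commutative discretely ordered rings. $\Delta_0=\Sigma_0=\Pi_0$ is the class of $\mathcal{L}_A$-formulas all of whose quantifiers are bounded; $\Sigma_{n+1}$ (resp. $\Pi_{n+1}$) formulas are those of the form $\exists \vec{y}\,\varphi$ with $\varphi\in\Pi_n$ (resp. $\forall \vec{y}\,\varphi$ with $\varphi\in\Sigma_n$), where $\vec{y}$ is a finite, possibly empty, tuple. Vector notation denotes finite (possibly empty) tuples of variables or elements; for tuples of the same length, $\vec{x}<\vec{u}$ means $x_i<u_i$ for every $i$. $M\subseteq N$ means $M$ is a substructure of $N$; $M\prec N$ means $N$ is an elementary extension of $M$; $M\prec_\Gamma N$ means $M\subseteq N$ and for every $\vec{a}\in M$ and every $\varphi(\vec{x})\in\Gamma$, $M\models\varphi(\vec{a})$ iff $N\models\varphi(\vec{a})$; $M\equiv_{\Sigma_k}K$ means $M$ and $K$ satisfy the same $\Sigma_k$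 sentences. $K$ is a cofinal extension of $M$ iff $M\subseteq K$ and for every $a\in K$ there is $b\in M$ with $K\models a<b$. For $M,N\models\mathbf{PA}^-$ with $M\subseteq N$, $\sup_N(M):=\{a\in N\mid \exists b\in M\ (N\models a\leq b)\}$, regarded as a substructure of $N$ (it is again a model of $\mathbf{PA}^-$). $\mathbf{Coll}_{\mathrm{w}}^{\mathrm{d}}(\Gamma)$ is the scheme $\forall \vec{z}\,\forall \vec{x}\,\exists \vec{y}\,\varphi(\vec{x},\vec{y},\vec{z})\to\forall \vec{z}\,\forall \vec{u}\,\exists \vec{v}\,\forall \vec{x}<\vec{u}\,\exists \vec{y}<\vec{v}\,\varphi(\vec{x},\vec{y},\vec{z})$ for $\varphi\in\Gamma$. $\mathbf{Coll}_{\mathrm{w}}^-(\Gamma)$ is the scheme $\forall \vec{x}\,\exists \vec{y}\,\varphi(\vec{x},\vec{y})\to\forall \vec{u}\,\exists \vec{v}\,\forall \vec{x}<\vec{u}\,\exists \vec{y}<\vec{v}\,\varphi(\vec{x},\vec{y})$ for $\varphi\in\Gamma$ (with no free variables other than $\vec{x},\vec{y}$). For $M\models\mathbf{PA}^-$ and $k\geq 0$: $M$ satisfies $\mathsf{end}_k$ iff for every $N\models\mathbf{PA}^-$ with $M\prec N$, $\sup_N(M)\prec_{\Sigma_k}N$; $M$ satisfies $\mathsf{cof}_k^{\equiv}$ iff for every $N\models\mathbf{PA}^-$ with $M\prec N$, $M\equiv_{\Sigma_k}\sup_N(M)$; $M$ satisfies $\mathsf{COF}_k^{\equiv}$ iff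 for every $K\models\mathbf{PA}^-$ such that $M\prec_{\Delta_0}K$ and $K$ is a cofinal extension of $M$, $M\equiv_{\Sigma_k}K$. *)

(* Defs.v *)
From mathcomp Require Import all_boot.
From mathcomp Require Import boolp.

Set Implicit Arguments.
Unset Strict Implicit.
Unset Printing Implicit Defensive.

(* Formulas of L_A are well-scoped de Bruijn: [form n] has its free variables
   among 'I_n, and a quantifier binds variable [ord0] of its body. *)
Inductive term (n : nat) : Type :=
  | TVar of 'I_n
  | TZero
  | TOne
  | TAdd of term n & term n
  | TMul of term n & term n.

Arguments TZero {n}.
Arguments TOne {n}.

Inductive form (n : nat) : Type :=
  | FEq of term n & term n
  | FLt of term n & term n
  | FNot of form n
  | FAnd of form n & form n
  | FOr of form n & form n
  | FImp of form n & form n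
  | FAll of form n.+1
  | FEx of form n.+1.

Fixpoint shift (n : nat) (t : term n) : term n.+1 :=
  match t with
  | TVar i => TVar (lift ord0 i)
  | TZero => TZero
  | TOne => TOne
  | TAdd s t => TAdd (shift s) (shift t)
  | TMul s t => TMul (shift s) (shift t)
  end.

(* [shift t] cannot mention the variable being bound. *)
Definition FAllLt (n : nat) (t : term n) (phi : form n.+1) : form n :=
  FAll (FImp (FLt (TVar ord0) (shift t)) phi).

Definition FExLt (n : nat) (t : term n) (phi : form n.+1) : form n :=
  FEx (FAnd (FLt (TVar ord0) (shift t)) phi).

Fixpoint exs (m n : nat) : form (m + n) -> form n :=
  match m with
  | 0 => fun phi => phi
  | m'.+1 => fun phi => @exs m' n (FEx phi)
  end.

Fixpoint alls (m n : nat) : form (m + n) -> form n :=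
  match m with
  | 0 => fun phi => phi
  | m'.+1 => fun phi => @alls m' n (FAll phi)
  end.

Definition form_class : Type := forall n : nat, form n -> Prop.

Inductive Delta0 (n : nat) : form n -> Prop :=
  | Delta0_Eq s t : Delta0 (FEq s t)
  | Delta0_Lt s t : Delta0 (FLt s t)
  | Delta0_Not phi : Delta0 phi -> Delta0 (FNot phi)
  | Delta0_And phi psi : Delta0 phi -> Delta0 psi -> Delta0 (FAnd phi psi)
  | Delta0_Or phi psi : Delta0 phi -> Delta0 psi -> Delta0 (FOr phi psi)
  | Delta0_Imp phi psi : Delta0 phi -> Delta0 psi -> Delta0 (FImp phi psi)
  | Delta0_AllLt t (phi : form n.+1) : Delta0 phi -> Delta0 (FAllLt t phi)
  | Delta0_ExLt t (phi : form n.+1) : Delta0 phi -> Delta0 (FExLt t phi).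

Fixpoint Sigma (k n : nat) (phi : form n) : Prop :=
  match k with
  | 0 => Delta0 phi
  | k'.+1 => exists (m : nat) (psi : form (m + n)), Pi k' psi /\ phi = exs psi
  end
with Pi (k n : nat) (phi : form n) : Prop :=
  match k with
  | 0 => Delta0 phi
  | k'.+1 => exists (m : nat) (psi : form (m + n)), Sigma k' psi /\ phi = alls psi
  end.

Record structure : Type := Structure {
  carrier :> Type;
  zero : carrier;
  one : carrier;
  add : carrier -> carrier -> carrier;
  mul : carrier -> carrier -> carrier;
  lt : carrier -> carrier -> Prop
}.

Arguments zero {s}.
Arguments one {s}.
Arguments add {s}.
Arguments mul {s}.
Arguments lt {s}.

Definition le (M : structure) (a b : M) : Prop := lt a b \/ a = b.

Fixpoint eval (M : structure) (n : nat) (e : n.-tuple M) (t : term n) : M :=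
  match t with
  | TVar i => tnth e i
  | TZero => zero
  | TOne => one
  | TAdd s t => add (eval e s) (eval e t)
  | TMul s t => mul (eval e s) (eval e t)
  end.

Fixpoint sat (M : structure) (n : nat) (e : n.-tuple M) (phi : form n) : Prop :=
  match phi with
  | FEq s t => eval e s = eval e t
  | FLt s t => lt (eval e s) (eval e t)
  | FNot psi => ~ sat e psi
  | FAnd psi chi => sat e psi /\ sat e chi
  | FOr psi chi => sat e psi \/ sat e chi
  | FImp psi chi => sat e psi -> sat e chi
  | FAll psi => forall a : M, sat (cons_tuple a e) psi
  | FEx psi => exists a : M, sat (cons_tuple a e) psi
  end.

(* The usual axioms for the non-negative part of a commutative discretely
   ordered ring (Kaye, Models of Peano Arithmetic, chapter 2). *)
Record PAminus (M : structure) : Prop := {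
  PAm_addA : forall x y z : M, add (add x y) z = add x (add y z);
  PAm_addC : forall x y : M, add x y = add y x;
  PAm_mulA : forall x y z : M, mul (mul x y) z = mul x (mul y z);
  PAm_mulC : forall x y : M, mul x y = mul y x;
  PAm_mulDr : forall x y z : M, mul x (add y z) = add (mul x y) (mul x z);
  PAm_addx0 : forall x : M, add x zero = x;
  PAm_mulx0 : forall x : M, mul x zero = zero;
  PAm_mulx1 : forall x : M, mul x one = x;
  PAm_lt_trans : forall x y z : M, lt x y -> lt y z -> lt x z;
  PAm_lt_irr : forall x : M, ~ lt x x;
  PAm_lt_total : forall x y : M, lt x y \/ x = y \/ lt y x;
  PAm_lt_add : forall x y z : M, lt x y -> lt (add x z) (add y z);
  PAm_lt_mul : forall x y z : M, lt zero z -> lt x y -> lt (mul x z) (mul y z);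
  PAm_sub : forall x y : M, lt x y -> exists z : M, add x z = y;
  PAm_lt01 : lt (zero : M) one;
  PAm_discrete : forall x : M, lt zero x -> le one x;
  PAm_ge0 : forall x : M, le zero x
}.

(* Substructures are taken up to isomorphism: M is a substructure of N via an
   embedding, and all relations between M and N are relative to it. *)
Record embedding (M N : structure) : Type := Embedding {
  emb :> M -> N;
  emb_inj : injective emb;
  emb_zero : emb zero = zero;
  emb_one : emb one = one;
  emb_add : forall a b : M, emb (add a b) = add (emb a) (emb b);
  emb_mul : forall a b : M, emb (mul a b) = mul (emb a) (emb b);
  emb_lt : forall a b : M, lt a b <-> lt (emb a) (emb b)
}.

Definition prec (Gamma : form_class) (M N : structure) (f : embedding M N) : Prop :=
  forall (n : nat) (phi : form n), Gamma n phi ->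
  forall a : n.-tuple M, sat a phi <-> sat (map_tuple f a) phi.

Definition elementary (M N : structure) (f : embedding M N) : Prop :=
  prec (fun _ _ => True) f.

Definition equiv_Sigma (k : nat) (M K : structure) : Prop :=
  forall phi : form 0, Sigma k phi ->
  (sat (nil_tuple M) phi <-> sat (nil_tuple K) phi).

Definition cofinal (M K : structure) (f : embedding M K) : Prop :=
  forall a : K, exists b : M, lt a (f b).

Section Sup.

Variables (M N : structure) (f : embedding M N) (hN : PAminus N).

Definition in_sup (a : N) : Prop := exists b : M, le a (f b).

Lemma PAm_le_trans (a b c : N) : le a b -> le b c -> le a c.
Proof.
move=> [ab|->] // [bc|<-]; left=> //; exact: PAm_lt_trans hN _ _ _ ab bc.
Qed.

Lemma PAm_le_add (a b c d : N) : le a b -> le c d -> le (add a c) (add b d).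
Proof.
move=> ab cd; apply: (@PAm_le_trans _ (add b c)).
  by case: ab => [ab|->]; [left; apply: PAm_lt_add|right].
case: cd => [cd|->]; last by right.
by left; rewrite !(PAm_addC hN b); apply: PAm_lt_add.
Qed.

Lemma PAm_le_mulr (a b c : N) : le a b -> le (mul a c) (mul b c).
Proof.
case=> [ab|->]; last by right.
case: (PAm_ge0 hN c) => [c0|<-]; first by left; apply: PAm_lt_mul.
by right; rewrite !(PAm_mulx0 hN).
Qed.

Lemma PAm_le_mul (a b c d : N) : le a b -> le c d -> le (mul a c) (mul b d).
Proof.
move=> ab cd; apply: PAm_le_trans (PAm_le_mulr c ab) _.
by rewrite !(PAm_mulC hN b); apply: PAm_le_mulr.
Qed.

Lemma in_sup_zero : in_sup zero.
Proof. by exists zero; right; rewrite emb_zero. Qed.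

Lemma in_sup_one : in_sup one.
Proof. by exists one; right; rewrite emb_one. Qed.

Lemma in_sup_add (a b : N) : in_sup a -> in_sup b -> in_sup (add a b).
Proof.
by move=> [c ac] [d bd]; exists (add c d); rewrite emb_add; apply: PAm_le_add.
Qed.

Lemma in_sup_mul (a b : N) : in_sup a -> in_sup b -> in_sup (mul a b).
Proof.
by move=> [c ac] [d bd]; exists (mul c d); rewrite emb_mul; apply: PAm_le_mul.
Qed.

Definition sup : structure := {|
  carrier := {a : N | in_sup a};
  zero := exist _ zero in_sup_zero;
  one := exist _ one in_sup_one;
  add := fun a b => exist _ (add (sval a) (sval b))
                      (in_sup_add (svalP a) (svalP b));
  mul := fun a b => exist _ (mul (sval a) (sval b))
                      (in_sup_mul (svalP a) (svalP b));
  lt := fun a b => lt (sval a) (sval b)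
|}.

Lemma sup_val_inj : injective (fun a : sup => sval a).
Proof.
by move=> [a ha] [b hb] /= ab; case: b / ab hb => hb; rewrite (Prop_irrelevance ha hb).
Qed.

Definition sup_incl : embedding sup N :=
  @Embedding sup N (fun a : sup => sval a) sup_val_inj erefl erefl
    (fun _ _ => erefl) (fun _ _ => erefl) (fun _ _ => iff_refl _).

End Sup.

Definition tuple_lt (M : structure) (n : nat) (x u : n.-tuple M) : Prop :=
  forall i : 'I_n, lt (tnth x i) (tnth u i).

(* Satisfaction of the collection schemes, with the outer implication and the
   quantifiers over tuples read off semantically; phi(x, y, z) has its
   variables in the order x, y, z. *)
Definition Coll_w_d (Gamma : form_class) (M : structure) : Prop :=
  forall (k l m : nat) (phi : form (k + l + m)), Gamma _ phi ->
  (forall (z : m.-tuple M) (x : k.-tuple M), exists y : l.-tuple M,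
     sat (cat_tuple (cat_tuple x y) z) phi) ->
  forall (z : m.-tuple M) (u : k.-tuple M), exists v : l.-tuple M,
  forall x : k.-tuple M, tuple_lt x u ->
  exists y : l.-tuple M, tuple_lt y v /\ sat (cat_tuple (cat_tuple x y) z) phi.

Definition Coll_w_minus (Gamma : form_class) (M : structure) : Prop :=
  forall (k l : nat) (phi : form (k + l)), Gamma _ phi ->
  (forall x : k.-tuple M, exists y : l.-tuple M, sat (cat_tuple x y) phi) ->
  forall u : k.-tuple M, exists v : l.-tuple M,
  forall x : k.-tuple M, tuple_lt x u ->
  exists y : l.-tuple M, tuple_lt y v /\ sat (cat_tuple x y) phi.

Definition end_cond (k : nat) (M : structure) : Prop :=
  forall (N : structure) (hN : PAminus N) (f : embedding M N),
  elementary f -> prec (Sigma k) (sup_incl f hN).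

Definition cof_equiv (k : nat) (M : structure) : Prop :=
  forall (N : structure) (hN : PAminus N) (f : embedding M N),
  elementary f -> equiv_Sigma k M (sup f hN).

Definition COF_equiv (k : nat) (M : structure) : Prop :=
  forall (K : structure) (hK : PAminus K) (f : embedding M K),
  prec Delta0 f -> cofinal f -> equiv_Sigma k M K.

(* Main.v *)
(* Collection for Sigma_{n+1} without parameters is collection with parameters,
   since parameters can be added to the universally quantified tuple. Applied to
   "forall y', ~ psi(x, y') or psi(x, y)" it yields strong collection for Pi_j
   formulas psi with j < n: on every bounded set of x, one bound suffices for all
   the witnesses that exist. If M is elementary in N, these bounds are in M, so
   sup_N(M) passes the Tarski-Vaught test for Sigma_n formulas. If K is a cofinal
   Delta_0-elementary extension of M, strong collection lets one replace each
   Sigma_n formula, on bounded sets, by one Delta_0 formula with parameters in M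
   that works in M and in K alike; this transfers Pi_{n+2} sentences from M to K.

   Conversely, if collection fails for a Pi_n formula psi below b, an ultrapower N
   of M over the final segments of M contains x < b with no witness for psi(x, -)
   in sup_N(M); with end_n this refutes in sup_N(M) a Pi_{n+2} sentence true in M. *)
From mathcomp Require Import all_boot.
From mathcomp Require Import boolp classical_sets filter.
Require Import Defs.

Set Implicit Arguments.
Unset Strict Implicit.
Unset Printing Implicit Defensive.

(** * Renaming of variables *)

Section Reindexing.

Context {T : Type}.

(** The semantic side of renaming: by [sat_rename], evaluating a formula renamed along [s] at [e]
    amounts to evaluating the original at [retuple e s]. *)
Definition retuple m n (e : n.-tuple T) (s : 'I_m -> 'I_n) : m.-tuple T :=
  [tuple tnth e (s i) | i < m].

Definition cat_map p m n (s : 'I_p -> 'I_n) (t : 'I_m -> 'I_n) (i : 'I_(p + m)) :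
    'I_n :=
  match split i with inl j => s j | inr j => t j end.

Lemma retuple_cat p m n (e : n.-tuple T) (s : 'I_p -> 'I_n) (t : 'I_m -> 'I_n) :
  retuple e (cat_map s t) = cat_tuple (retuple e s) (retuple e t).
Proof.
apply: eq_from_tnth => i; rewrite tnth_mktuple /cat_map -[in RHS](splitK i).
by case: (split i) => j /=; rewrite (tnth_lshift, tnth_rshift) tnth_mktuple.
Qed.

Lemma retuple_id n (e : n.-tuple T) : retuple e id = e.
Proof. by apply: eq_from_tnth => i; rewrite tnth_mktuple. Qed.

Lemma retuple_lshift m p n (e : p.-tuple T) (f : n.-tuple T) (s : 'I_m -> 'I_p) :
  retuple (cat_tuple e f) (fun i => lshift n (s i)) = retuple e s.
Proof. by apply: eq_from_tnth => i; rewrite !tnth_mktuple tnth_lshift. Qed.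

Lemma retuple_rshift m p n (e : p.-tuple T) (f : n.-tuple T) (s : 'I_m -> 'I_n) :
  retuple (cat_tuple e f) (fun i => rshift p (s i)) = retuple f s.
Proof. by apply: eq_from_tnth => i; rewrite !tnth_mktuple tnth_rshift. Qed.

Lemma retuple_lshift_id p n (e : p.-tuple T) (f : n.-tuple T) :
  retuple (cat_tuple e f) (@lshift p n) = e.
Proof. by rewrite -[RHS]retuple_id -(retuple_lshift e f id). Qed.

Lemma retuple_rshift_id p n (e : p.-tuple T) (f : n.-tuple T) :
  retuple (cat_tuple e f) (@rshift p n) = f.
Proof. by rewrite -[RHS]retuple_id -(retuple_rshift e f id). Qed.

Lemma cat_retuple m n (e : (m + n).-tuple T) :
  e = cat_tuple (retuple e (@lshift m n)) (retuple e (@rshift m n)).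
Proof.
rewrite -retuple_cat; apply: eq_from_tnth => i.
rewrite tnth_mktuple /cat_map -[in LHS](splitK i).
by case: (split i).
Qed.

Definition lift_map m n (s : 'I_m -> 'I_n) (i : 'I_m.+1) : 'I_n.+1 :=
  if unlift ord0 i is Some j then lift ord0 (s j) else ord0.

Lemma retuple_lift_map m n (x : T) (e : n.-tuple T) (s : 'I_m -> 'I_n) :
  retuple (cons_tuple x e) (lift_map s) = cons_tuple x (retuple e s).
Proof.
apply: eq_from_tnth => i; rewrite tnth_mktuple /lift_map.
case: unliftP => [j ->|->]; last by rewrite !tnth0.
by rewrite !tnthS tnth_mktuple.
Qed.

Lemma cat_cons_tuple m n (x : T) (a : m.-tuple T) (e : n.-tuple T) :
  cat_tuple (cons_tuple x a) e = cons_tuple x (cat_tuple a e).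
Proof. exact: val_inj. Qed.

Lemma cat_nil_tuple n (a : 0.-tuple T) (e : n.-tuple T) : cat_tuple a e = e.
Proof. by rewrite (tuple0 a); apply: val_inj. Qed.

End Reindexing.

Lemma map_cat_tuple (T U : Type) (f : T -> U) m n (a : m.-tuple T) (e : n.-tuple T) :
  map_tuple f (cat_tuple a e) = cat_tuple (map_tuple f a) (map_tuple f e).
Proof. by apply: val_inj; rewrite /= map_cat. Qed.

Lemma map_cons_tuple (T U : Type) (f : T -> U) n (x : T) (e : n.-tuple T) :
  map_tuple f (cons_tuple x e) = cons_tuple (f x) (map_tuple f e).
Proof. exact: val_inj. Qed.

Section Renaming.

Fixpoint rename_term m n (s : 'I_m -> 'I_n) (t : term m) : term n :=
  match t with
  | TVar i => TVar (s i)
  | TZero => TZero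
  | TOne => TOne
  | TAdd t u => TAdd (rename_term s t) (rename_term s u)
  | TMul t u => TMul (rename_term s t) (rename_term s u)
  end.

(** The target arity is quantified after [phi], because the call under a quantifier uses a map into
    arity [n.+1]. *)
Fixpoint rename m (phi : form m) : forall n, ('I_m -> 'I_n) -> form n :=
  match phi with
  | FEq t u => fun n s => FEq (rename_term s t) (rename_term s u)
  | FLt t u => fun n s => FLt (rename_term s t) (rename_term s u)
  | FNot phi => fun n s => FNot (rename phi s)
  | FAnd phi psi => fun n s => FAnd (rename phi s) (rename psi s)
  | FOr phi psi => fun n s => FOr (rename phi s) (rename psi s)
  | FImp phi psi => fun n s => FImp (rename phi s) (rename psi s)
  | FAll phi => fun n s => FAll (rename phi (lift_map s))
  | FEx phi => fun n s => FEx (rename phi (lift_map s))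
  end.

Lemma rename_shift m n (s : 'I_m -> 'I_n) (t : term m) :
  rename_term (lift_map s) (shift t) = shift (rename_term s t).
Proof.
elim: t => //= [i|t -> u -> //|t -> u -> //].
by rewrite /lift_map liftK.
Qed.

Lemma lift_map0 m n (s : 'I_m -> 'I_n) : lift_map s ord0 = ord0.
Proof. by rewrite /lift_map unlift_none. Qed.

(** Bounded quantifiers are recognised by the literal bound [shift t] on variable [ord0];
    [rename_shift] and [lift_map0] restore this pattern after renaming. *)
Lemma Delta0_rename m (phi : form m) : Delta0 phi ->
  forall n (s : 'I_m -> 'I_n), Delta0 (rename phi s).
Proof.
elim=> {m phi} /=; do ?by move=> *; constructor; auto.
  move=> m t phi _ IH n s; rewrite rename_shift lift_map0.
  exact: Delta0_AllLt.
move=> m t phi _ IH n s; rewrite rename_shift lift_map0.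
exact: Delta0_ExLt.
Qed.

Lemma eval_rename (M : structure) m n (s : 'I_m -> 'I_n) (e : n.-tuple M) t :
  eval e (rename_term s t) = eval (retuple e s) t.
Proof. by elim: t => //= [i|t -> u -> //|t -> u -> //]; rewrite tnth_mktuple. Qed.

Lemma eval_shift (M : structure) n (a : M) (e : n.-tuple M) t :
  eval (cons_tuple a e) (shift t) = eval e t.
Proof. by elim: t => //= [i|t -> u -> //|t -> u -> //]; rewrite tnthS. Qed.

Lemma sat_rename (M : structure) m (phi : form m) :
  forall n (s : 'I_m -> 'I_n) (e : n.-tuple M),
  sat e (rename phi s) <-> sat (retuple e s) phi.
Proof.
elim: phi => {m} //=.
- by move=> m t u n s e; rewrite !eval_rename.
- by move=> m t u n s e; rewrite !eval_rename.
- by move=> m phi IH n s e; rewrite IH.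
- by move=> m phi IH psi IH' n s e; rewrite IH IH'.
- by move=> m phi IH psi IH' n s e; rewrite IH IH'.
- by move=> m phi IH psi IH' n s e; rewrite IH IH'.
- by move=> m phi IH n s e; split=> H a; move: (H a); rewrite IH retuple_lift_map.
- by move=> m phi IH n s e; split=> -[a H]; exists a; move: H; rewrite IH retuple_lift_map.
Qed.

End Renaming.

Lemma sat_exs (M : structure) m n (phi : form (m + n)) (e : n.-tuple M) :
  sat e (exs phi) <-> exists a : m.-tuple M, sat (cat_tuple a e) phi.
Proof.
elim: m phi => [|m IH] phi /=.
  split=> [H|[a]]; last by rewrite cat_nil_tuple.
  by exists (nil_tuple M); rewrite cat_nil_tuple.
rewrite IH /=; split=> [[a [x H]]|[a]].
  by exists (cons_tuple x a); rewrite cat_cons_tuple.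
case/tupleP: a => x a; rewrite cat_cons_tuple => H; by exists a, x.
Qed.

Lemma sat_alls (M : structure) m n (phi : form (m + n)) (e : n.-tuple M) :
  sat e (alls phi) <-> forall a : m.-tuple M, sat (cat_tuple a e) phi.
Proof.
elim: m phi => [|m IH] phi /=.
  split=> [H a|/(_ (nil_tuple M))]; by rewrite cat_nil_tuple.
rewrite IH /=; split=> [H a|H a x].
  by case/tupleP: a => x a; rewrite cat_cons_tuple; apply: H.
by have := H (cons_tuple x a); rewrite cat_cons_tuple.
Qed.

(** * Closure properties of the quantifier hierarchy *)

(* Every structure has an element, so prenexing is sound in all structures. *)
Definition equivalent n (phi psi : form n) : Prop :=
  forall (M : structure) (e : n.-tuple M), sat e phi <-> sat e psi.

(** [Sigma] and [Pi] ask for a literal quantifier prefix; closing them under equivalence makes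
    negation, disjunction and change of level available. *)
Definition SigmaE k : form_class := fun n phi =>
  exists2 psi : form n, Sigma k psi & equivalent phi psi.

Definition PiE k : form_class := fun n phi =>
  exists2 psi : form n, Pi k psi & equivalent phi psi.

Lemma Sigma_SigmaE k n (phi : form n) : Sigma k phi -> SigmaE k phi.
Proof. by exists phi. Qed.

Lemma Pi_PiE k n (phi : form n) : Pi k phi -> PiE k phi.
Proof. by exists phi. Qed.

Lemma equivalent_SigmaE k n (phi psi : form n) :
  equivalent phi psi -> SigmaE k psi -> SigmaE k phi.
Proof. by move=> H [chi ? H']; exists chi => // M e; rewrite H H'. Qed.

Lemma equivalent_PiE k n (phi psi : form n) :
  equivalent phi psi -> PiE k psi -> PiE k phi.
Proof. by move=> H [chi ? H']; exists chi => // M e; rewrite H H'. Qed.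

Lemma SigmaE_exs k m n (phi : form (m + n)) : PiE k phi -> SigmaE k.+1 (exs phi).
Proof.
case=> psi Hpsi H; exists (exs psi); first by exists m, psi.
by move=> M e; rewrite !sat_exs; split=> -[a Ha]; exists a; apply/H.
Qed.

Lemma PiE_alls k m n (phi : form (m + n)) : SigmaE k phi -> PiE k.+1 (alls phi).
Proof.
case=> psi Hpsi H; exists (alls psi); first by exists m, psi.
by move=> M e; rewrite !sat_alls; split=> Ha a; apply/H.
Qed.

(** The added block of quantifiers may be empty. *)
Lemma SigmaE_of_PiE k n (phi : form n) : PiE k phi -> SigmaE k.+1 phi.
Proof. exact: (@SigmaE_exs k 0 n). Qed.

Lemma PiE_of_SigmaE k n (phi : form n) : SigmaE k phi -> PiE k.+1 phi.
Proof. exact: (@PiE_alls k 0 n). Qed.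

Lemma SigmaE_PiE_succ k n (phi : form n) :
  (SigmaE k phi -> SigmaE k.+1 phi) /\ (PiE k phi -> PiE k.+1 phi).
Proof.
elim: k n phi => [|k IH] n phi.
  by split=> H; [apply: SigmaE_of_PiE|apply: PiE_of_SigmaE].
split=> -[chi [m [psi [Hpsi ->]]] H].
  by apply: (equivalent_SigmaE H); apply: SigmaE_exs; apply IH; apply: Pi_PiE.
by apply: (equivalent_PiE H); apply: PiE_alls; apply IH; apply: Sigma_SigmaE.
Qed.

Lemma SigmaE_le j k n (phi : form n) : j <= k -> SigmaE j phi -> SigmaE k phi.
Proof.
move/subnK<-; elim: (k - j) => [//|d IH] H; rewrite addSn.
by apply: (proj1 (SigmaE_PiE_succ _ _)); apply: IH.
Qed.

(** One induction proves both halves, since negation exchanges the two classes; at level 0 they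
    coincide. *)
Lemma SigmaE_PiE_not k n (phi : form n) :
  (SigmaE k phi -> PiE k (FNot phi)) /\ (PiE k phi -> SigmaE k (FNot phi)).
Proof.
elim: k n phi => [|k IH] n phi.
  by split=> -[psi H E]; exists (FNot psi); do ?exact: Delta0_Not; move=> M e /=; rewrite E.
split=> -[chi [m [psi [Hpsi ->]]] H].
  apply: (@equivalent_PiE _ _ _ (alls (FNot psi))).
    move=> M e /=; rewrite H sat_exs sat_alls /=; exact: iff_sym (forallNP _).
  by apply: PiE_alls; apply IH; apply: Pi_PiE.
apply: (@equivalent_SigmaE _ _ _ (exs (FNot psi))).
  move=> M e /=; rewrite H sat_exs sat_alls /=; exact: iff_sym (existsNP _).
by apply: SigmaE_exs; apply IH; apply: Sigma_SigmaE.
Qed.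

Lemma SigmaE_not k n (phi : form n) : PiE k phi -> SigmaE k (FNot phi).
Proof. by case: (SigmaE_PiE_not k phi). Qed.

Lemma PiE_not k n (phi : form n) : SigmaE k phi -> PiE k (FNot phi).
Proof. by case: (SigmaE_PiE_not k phi). Qed.

Lemma SigmaE_PiE_rename k m (phi : form m) n (s : 'I_m -> 'I_n) :
  (SigmaE k phi -> SigmaE k (rename phi s)) /\ (PiE k phi -> PiE k (rename phi s)).
Proof.
elim: k m phi n s => [|k IH] m phi n s.
  split=> -[psi H E]; exists (rename psi s); do ?exact: Delta0_rename;
    by move=> M e /=; rewrite !sat_rename E.
split=> -[chi [q [psi [Hpsi ->]]] H];
  pose s' := cat_map (lshift n) (fun i => rshift q (s i)).
  apply: (@equivalent_SigmaE _ _ _ (exs (rename psi s'))).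
    move=> M e; rewrite sat_rename H !sat_exs.
    by split=> -[a Ha]; exists a; move: Ha;
      rewrite sat_rename retuple_cat retuple_rshift retuple_lshift_id.
  by apply: SigmaE_exs; apply IH; apply: Pi_PiE.
apply: (@equivalent_PiE _ _ _ (alls (rename psi s'))).
  move=> M e; rewrite sat_rename H !sat_alls.
  by split=> Ha a; move: (Ha a);
    rewrite sat_rename retuple_cat retuple_rshift retuple_lshift_id.
by apply: PiE_alls; apply IH; apply: Sigma_SigmaE.
Qed.

Lemma SigmaE_rename k m (phi : form m) n (s : 'I_m -> 'I_n) :
  SigmaE k phi -> SigmaE k (rename phi s).
Proof. by case: (SigmaE_PiE_rename k phi s). Qed.

Lemma PiE_rename k m (phi : form m) n (s : 'I_m -> 'I_n) :
  PiE k phi -> PiE k (rename phi s).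
Proof. by case: (SigmaE_PiE_rename k phi s). Qed.

(** The two blocks are placed side by side over the shared free variables, so that a single block
    binds both. *)
Definition prenex_or p q n (phi : form (p + n)) (psi : form (q + n)) :
    form (p + q + n) :=
  FOr (rename phi (cat_map (fun i => lshift n (lshift q i)) (@rshift (p + q) n)))
      (rename psi (cat_map (fun i => lshift n (rshift p i)) (@rshift (p + q) n))).

Lemma sat_prenex_or (M : structure) p q n (phi : form (p + n)) (psi : form (q + n))
    (a : p.-tuple M) (b : q.-tuple M) (e : n.-tuple M) :
  sat (cat_tuple (cat_tuple a b) e) (prenex_or phi psi) <->
  sat (cat_tuple a e) phi \/ sat (cat_tuple b e) psi.
Proof.
rewrite /= !sat_rename !retuple_cat.
rewrite (retuple_lshift _ _ (@lshift p q)) (retuple_lshift _ _ (@rshift p q)).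
by rewrite retuple_lshift_id !retuple_rshift_id.
Qed.

Lemma SigmaE_PiE_or k n (phi psi : form n) :
  (SigmaE k phi -> SigmaE k psi -> SigmaE k (FOr phi psi)) /\
  (PiE k phi -> PiE k psi -> PiE k (FOr phi psi)).
Proof.
elim: k n phi psi => [|k IH] n phi psi.
  by split=> -[phi' H E] [psi' H' E']; exists (FOr phi' psi');
    do ?exact: Delta0_Or; move=> M e /=; rewrite E E'.
split=> -[_ [p [phi' [Hphi ->]]] E] [_ [q [psi' [Hpsi ->]]] E'].
  apply: (@equivalent_SigmaE _ _ _ (exs (prenex_or phi' psi'))).
    move=> M e; rewrite [sat _ (FOr _ _)]/= E E' !sat_exs; split.
      case=> -[a Ha].
        (* The block of the other disjunct is irrelevant and is filled with zeros. *)
        by exists (cat_tuple a (nseq_tuple q zero)); apply/sat_prenex_or; left.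
      by exists (cat_tuple (nseq_tuple p zero) a); apply/sat_prenex_or; right.
    case=> ab; rewrite (cat_retuple ab).
    by move/sat_prenex_or=> [H|H]; [left|right]; eexists; exact: H.
  by apply: SigmaE_exs; apply IH; apply: PiE_rename; apply: Pi_PiE.
apply: (@equivalent_PiE _ _ _ (alls (prenex_or phi' psi'))).
  move=> M e; rewrite [sat _ (FOr _ _)]/= E E' !sat_alls; split.
    by move=> H ab; rewrite (cat_retuple ab); apply/sat_prenex_or; case: H => H; [left|right].
  (* If both universal statements failed, their counterexamples together would refute the joint
     one. *)
  move=> H; apply: contrapT => /not_orP[/existsNP[a Ha] /existsNP[b Hb]].
  by case/sat_prenex_or: (H (cat_tuple a b)).
by apply: PiE_alls; apply IH; apply: SigmaE_rename; apply: Sigma_SigmaE.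
Qed.

(** * Bounds and collection *)

(** In a linear order one common bound serves as well as a tuple of bounds, and it costs only one
    parameter in a formula. *)
Definition bounded (M : structure) n (b : M) (x : n.-tuple M) : Prop :=
  forall i, lt (tnth x i) b.

Lemma bounded_cons (M : structure) n (b a : M) (x : n.-tuple M) :
  bounded b (cons_tuple a x) <-> lt a b /\ bounded b x.
Proof.
split=> [H|[Ha Hx] i].
  by split=> [|i]; [have := H ord0|have := H (lift ord0 i)]; rewrite (tnth0, tnthS).
by case: (unliftP ord0 i) => [j ->|->]; rewrite (tnthS, tnth0).
Qed.

Lemma bounded_cat (M : structure) m n (b : M) (x : m.-tuple M) (y : n.-tuple M) :
  bounded b (cat_tuple x y) <-> bounded b x /\ bounded b y.
Proof.
split=> [H|[Hx Hy] i].
  by split=> i; [have := H (lshift n i)|have := H (rshift m i)];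
    rewrite (tnth_lshift, tnth_rshift).
by rewrite -(splitK i); case: (split i) => j /=; rewrite (tnth_lshift, tnth_rshift).
Qed.

Lemma bounded_map (M N : structure) (f : embedding M N) n (b : M) (x : n.-tuple M) :
  bounded (f b) (map_tuple f x) <-> bounded b x.
Proof. by split=> H i; move: (H i); rewrite tnth_map -emb_lt. Qed.

(** The bound [t] mentions only the outer variables; [rshift] carries it past the rest of the
    block. *)
Fixpoint exsLt m n (t : term n) : form (m + n) -> form n :=
  match m with
  | 0 => fun phi => phi
  | m'.+1 => fun phi =>
      @exsLt m' n t (FExLt (rename_term (@rshift m' n) t) phi)
  end.

(** Taking the dual of [exsLt] spares a second induction on the block. *)
Definition allsLt m n (t : term n) (phi : form (m + n)) : form n :=
  FNot (exsLt t (FNot phi)).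

Lemma Delta0_exsLt m n (t : term n) (phi : form (m + n)) :
  Delta0 phi -> Delta0 (exsLt t phi).
Proof.
by elim: m phi => [//|m IH] phi H /=; apply: IH; apply: Delta0_ExLt.
Qed.

Lemma Delta0_allsLt m n (t : term n) (phi : form (m + n)) :
  Delta0 phi -> Delta0 (allsLt t phi).
Proof. by move=> H; apply: Delta0_Not; apply: Delta0_exsLt; apply: Delta0_Not. Qed.

Lemma sat_exsLt (M : structure) m n (t : term n) (phi : form (m + n)) (e : n.-tuple M) :
  sat e (exsLt t phi) <->
  exists2 a : m.-tuple M, bounded (eval e t) a & sat (cat_tuple a e) phi.
Proof.
elim: m phi => [|m IH] phi /=.
  split=> [H|[a _]]; last by rewrite cat_nil_tuple.
  by exists (nil_tuple M); [case|rewrite cat_nil_tuple].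
rewrite IH; split=> [[a Ha [x]]|[a]].
  rewrite /= eval_shift eval_rename retuple_rshift_id => -[Hx H].
  by exists (cons_tuple x a); [apply/bounded_cons|rewrite cat_cons_tuple].
case/tupleP: a => x a; rewrite cat_cons_tuple => /bounded_cons[Hx Ha] H.
exists a => //; exists x.
by rewrite /= eval_shift eval_rename retuple_rshift_id.
Qed.

Lemma sat_allsLt (M : structure) m n (t : term n) (phi : form (m + n)) (e : n.-tuple M) :
  sat e (allsLt t phi) <->
  forall a : m.-tuple M, bounded (eval e t) a -> sat (cat_tuple a e) phi.
Proof.
rewrite [sat e _]/= sat_exsLt; split=> [H a Ha|H [a Ha] /=]; last by apply; apply: H.
by apply: contrapT => Hn; apply: H; exists a.
Qed.

Section Order.

Context {M : structure} (hM : PAminus M).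

Lemma lt_le_trans (a b c : M) : lt a b -> le b c -> lt a c.
Proof. by move=> ab [bc|<-//]; apply: PAm_lt_trans hM _ _ _ ab bc. Qed.

Lemma le_lt_trans (a b c : M) : le a b -> lt b c -> lt a c.
Proof. by move=> [ab|->//] bc; apply: PAm_lt_trans hM _ _ _ ab bc. Qed.

Lemma lt_succ (a : M) : lt a (add a one).
Proof.
have := PAm_lt_add hM a (PAm_lt01 hM).
by rewrite (PAm_addC hM) (PAm_addx0 hM) (PAm_addC hM).
Qed.

Lemma le_total (a b : M) : le a b \/ le b a.
Proof.
by case: (PAm_lt_total hM a b) => [H|[->|H]]; [left; left|left; right|right; left].
Qed.

Lemma le_upper_bound (a b : M) : exists2 c, le a c & le b c.
Proof. by case: (le_total a b) => H; [exists b|exists a] => //; right. Qed.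

Lemma bounded_le n (b c : M) (x : n.-tuple M) : bounded b x -> le b c -> bounded c x.
Proof. by move=> H bc i; apply: lt_le_trans bc. Qed.

Lemma bounded_exists n (x : n.-tuple M) : exists b, bounded b x.
Proof.
elim: n x => [|n IH] x; first by exists zero; case.
case/tupleP: x => a x; have [b Hb] := IH x.
have [c Hac Hbc] := le_upper_bound (add a one) b.
exists c; apply/bounded_cons; split; last exact: bounded_le Hbc.
exact: lt_le_trans (lt_succ a) Hac.
Qed.

End Order.

Lemma eval_emb (M N : structure) (f : embedding M N) n (e : n.-tuple M) t :
  eval (map_tuple f e) t = f (eval e t).
Proof.
elim: t => /= [i|||t -> u ->|t -> u ->]; rewrite ?tnth_map //.
- by rewrite emb_zero.
- by rewrite emb_one.
- by rewrite emb_add.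
- by rewrite emb_mul.
Qed.

Lemma prec_SigmaE k (M N : structure) (f : embedding M N) :
  prec (Sigma k) f -> prec (SigmaE k) f.
Proof. by move=> H n phi [psi Hpsi E] a; rewrite !E; apply: H. Qed.

Lemma prec_PiE k (M N : structure) (f : embedding M N) :
  prec (Sigma k) f -> prec (PiE k) f.
Proof.
move=> /prec_SigmaE H n phi /SigmaE_not/H{}H a.
by have /= {}H := H a; rewrite -[sat a phi]notK -[sat (map_tuple _ _) _]notK H.
Qed.

Lemma equiv_SigmaE k (M N : structure) : equiv_Sigma k M N ->
  forall phi : form 0, SigmaE k phi -> (sat (nil_tuple M) phi <-> sat (nil_tuple N) phi).
Proof. by move=> H phi [psi Hpsi E]; rewrite !E; apply: H. Qed.

(** A working form of the parameter-free scheme: bounds are single elements, and the witnesses come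
    first so that [exs] binds them. *)
Definition collection (Gamma : form_class) (M : structure) : Prop :=
  forall m n (psi : form (m + n)), Gamma _ psi ->
  (forall x : n.-tuple M, exists y : m.-tuple M, sat (cat_tuple y x) psi) ->
  forall b : M, exists c : M, forall x : n.-tuple M, bounded b x ->
  exists2 y : m.-tuple M, bounded c y & sat (cat_tuple y x) psi.

Definition strong_collection (Gamma : form_class) (M : structure) : Prop :=
  forall m n (psi : form (m + n)), Gamma _ psi ->
  forall b : M, exists c : M, forall x : n.-tuple M, bounded b x ->
  (exists y : m.-tuple M, sat (cat_tuple y x) psi) ->
  exists2 y : m.-tuple M, bounded c y & sat (cat_tuple y x) psi.

Lemma sat_swap (M : structure) m n (psi : form (m + n)) (x : n.-tuple M) (y : m.-tuple M) :
  sat (cat_tuple x y) (rename psi (cat_map (@rshift n m) (@lshift n m))) <->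
  sat (cat_tuple y x) psi.
Proof. by rewrite sat_rename retuple_cat retuple_rshift_id retuple_lshift_id. Qed.

(** A single bound becomes a constant tuple, and a tuple of bounds is replaced by a common upper
    bound; the two blocks of variables are swapped by renaming. *)
Lemma Coll_w_minusP (M : structure) k : PAminus M ->
  Coll_w_minus (Sigma k) M <-> collection (SigmaE k) M.
Proof.
move=> hM; split=> [H m n psi Hpsi Hxy b|H n m phi Hphi Hxy u].
  have [chi Hchi E] := SigmaE_rename (cat_map (@rshift n m) (@lshift n m)) Hpsi.
  have chiP (x : n.-tuple M) (y : m.-tuple M) : sat (cat_tuple x y) chi <-> sat (cat_tuple y x) psi.
    by rewrite -E sat_swap.
  have {}Hxy : forall x : n.-tuple M, exists y : m.-tuple M, sat (cat_tuple x y) chi.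
    by move=> x; have [y] := Hxy x; exists y; apply/chiP.
  have [v Hv] := H _ _ _ Hchi Hxy (nseq_tuple n b).
  have [c Hc] := bounded_exists hM v.
  exists c => x Hx; have [|y [Hyv Hy]] := Hv x.
    by move=> i; rewrite tnth_nseq.
  by exists y; [move=> i; apply: PAm_lt_trans (Hyv i) (Hc i)|apply/chiP].
have chiP x y := @sat_swap M n m phi y x.
have {}Hxy : forall x : n.-tuple M, exists y : m.-tuple M, sat (cat_tuple y x)
    (rename phi (cat_map (@rshift m n) (@lshift m n))).
  by move=> x; have [y] := Hxy x; exists y; apply/chiP.
have [b Hb] := bounded_exists hM u.
have [c Hc] := H _ _ _ (SigmaE_rename _ (Sigma_SigmaE Hphi)) Hxy b.
exists (nseq_tuple m c) => x Hx.
have [|y Hyc Hy] := Hc x; first by move=> i; apply: PAm_lt_trans (Hx i) (Hb i).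
by exists y; split; [move=> i; rewrite tnth_nseq|apply/chiP].
Qed.

(** The premise is total in the parameters [z] as well, so they can join the tuple [x] over which
    collection is applied. The other direction takes an empty [z]. *)
Lemma Coll_w_d_minus (M : structure) k : PAminus M ->
  Coll_w_d (Sigma k) M <-> Coll_w_minus (Sigma k) M.
Proof.
move=> hM; split=> [H n m phi Hphi Hxy u|H n l m phi Hphi Hxy z u].
  have [psi Hpsi E] := SigmaE_rename (@lshift (n + m) 0) (Sigma_SigmaE Hphi).
  have psiP (x : n.-tuple M) (y : m.-tuple M) (z : 0.-tuple M) :
      sat (cat_tuple (cat_tuple x y) z) psi <-> sat (cat_tuple x y) phi.
    by rewrite -E sat_rename retuple_lshift_id.
  have [|v Hv] := H _ _ _ _ Hpsi _ (nil_tuple M) u.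
    by move=> z x; have [y] := Hxy x; exists y; apply/psiP.
  by exists v => x Hx; have [y [Hyv /psiP Hy]] := Hv x Hx; exists y.
pose s := cat_map (cat_map (fun i => rshift l (@lshift n m i)) (@lshift l (n + m)))
  (fun i => rshift l (@rshift n m i)).
have psiP (x : n.-tuple M) y z' : sat (cat_tuple y (cat_tuple x z')) (rename phi s) <->
    sat (cat_tuple (cat_tuple x y) z') phi.
  rewrite sat_rename !retuple_cat retuple_lshift_id (retuple_rshift _ _ (@lshift n m)).
  by rewrite (retuple_rshift _ _ (@rshift n m)) retuple_lshift_id retuple_rshift_id.
move/(Coll_w_minusP _ hM): H => H.
(* This [b] lies above the given [z] too, so the pairs [(x, z)] with [x] below [u] are among the
   bounded tuples. *)
have [b /bounded_cat[Hb Hz]] := bounded_exists hM (cat_tuple u z).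
have [|c Hc] := H _ _ _ (SigmaE_rename s (Sigma_SigmaE Hphi)) _ b.
  move=> xz; rewrite (cat_retuple xz).
  move: (retuple xz (@lshift n m)) (retuple xz (@rshift n m)) => x z'.
  by have [y] := Hxy z' x; exists y; apply/psiP.
exists (nseq_tuple l c) => x Hx; have [|y Hyc Hy] := Hc (cat_tuple x z).
  by apply/bounded_cat; split=> // i; apply: PAm_lt_trans (Hx i) (Hb i).
by exists y; split; [move=> i; rewrite tnth_nseq|apply/psiP].
Qed.

(** The formula is the disjunction of [forall y', ~ psi], which is Pi_{k+1}, and [psi], which is
    Pi_k; hence it is Pi_{k+1} and so Sigma_{k+2}. *)
Lemma SigmaE_witness_total k m n (psi : form (m + n)) : PiE k psi ->
  exists2 chi : form (m + n), SigmaE k.+2 chi &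
    forall (M : structure) (y : m.-tuple M) (x : n.-tuple M),
    sat (cat_tuple y x) chi <->
    ((exists y', sat (cat_tuple y' x) psi) -> sat (cat_tuple y x) psi).
Proof.
move=> Hpsi; exists (FOr (rename (alls (FNot psi)) (@rshift m n)) psi).
  apply: SigmaE_of_PiE; apply SigmaE_PiE_or; last exact: (proj2 (SigmaE_PiE_succ _ _)).
  by apply: PiE_rename; apply: PiE_alls; apply: SigmaE_not.
move=> M y x; rewrite /= sat_rename retuple_rshift_id sat_alls /=; split.
  by case=> [H [y' /H]|].
move=> H; case: (pselect (exists y', sat (cat_tuple y' x) psi)) => [/H|Hn]; first by right.
by left=> y' Hy'; apply: Hn; exists y'.
Qed.

(** Some [y] always satisfies the formula of [SigmaE_witness_total], so plain collection applies to
    it; [j < k] puts its level [j.+2] within [k.+1]. *)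
Lemma strong_collectionP (M : structure) j k :
  collection (SigmaE k.+1) M -> j < k -> strong_collection (PiE j) M.
Proof.
move=> H jk m n psi /SigmaE_witness_total[chi Hchi chiP] b.
have jk2 : j.+2 <= k.+1 by [].
have [|c Hc] := H _ _ _ (SigmaE_le jk2 Hchi) _ b.
  move=> x; case: (pselect (exists y : m.-tuple M, sat (cat_tuple y x) psi)).
    by case=> y Hy; exists y; apply/chiP.
  (* Without a witness any tuple satisfies [chi]. *)
  by move=> Hn; exists (nseq_tuple m zero); apply/chiP=> /Hn.
exists c => x Hx Hy; have [y Hyc /chiP{}Hy'] := Hc x Hx.
by exists y => //; apply: Hy'.
Qed.

(** * Cofinal extensions *)

(* Variables [y, x, p] become [y, x, c, p], where [c] are [r] new variables. *)
Definition insert_params r m n q (delta : form (m + n + q)) : form (m + (n + (r + q))) :=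
  rename delta (cat_map (cat_map (@lshift m (n + (r + q)))
                                 (fun i => rshift m (lshift (r + q) i)))
                        (fun i => rshift m (rshift n (rshift r i)))).

Lemma sat_insert_params (M : structure) r m n q (delta : form (m + n + q))
    (y : m.-tuple M) (x : n.-tuple M) (c : r.-tuple M) (p : q.-tuple M) :
  sat (cat_tuple y (cat_tuple x (cat_tuple c p))) (insert_params r delta) <->
  sat (cat_tuple (cat_tuple y x) p) delta.
Proof.
rewrite sat_rename !retuple_cat retuple_lshift_id.
rewrite (retuple_rshift _ _ (@lshift n (r + q))) retuple_lshift_id.
rewrite (retuple_rshift _ _ (fun i => rshift n (rshift r i))).
by rewrite (retuple_rshift _ _ (@rshift r q)) retuple_rshift_id.
Qed.

Lemma Delta0_insert_params r m n q (delta : form (m + n + q)) :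
  Delta0 delta -> Delta0 (insert_params r delta).
Proof. by move=> H; apply: Delta0_rename. Qed.

Lemma tnth_param (M : structure) n r q (x : n.-tuple M) (c : r.-tuple M) (p : q.-tuple M) i :
  tnth (cat_tuple x (cat_tuple c p)) (rshift n (lshift q i)) = tnth c i.
Proof. by rewrite tnth_rshift tnth_lshift. Qed.

Lemma map_tuple1 (T U : Type) (g : T -> U) a : map_tuple g [tuple a] = [tuple g a].
Proof. exact: val_inj. Qed.

Lemma eval_param1 (M : structure) n q (x : n.-tuple M) (c : M) (p : q.-tuple M) :
  eval (cat_tuple x (cat_tuple [tuple c] p)) (TVar (rshift n (lshift q ord0))) = c.
Proof. by rewrite /= tnth_param. Qed.

Section CofinalExtension.

Context {M K : structure} (hM : PAminus M) (hK : PAminus K) (f : embedding M K).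
Hypotheses (f_Delta0 : prec Delta0 f) (f_cofinal : cofinal f).

Lemma cofinal_bounded n (x : n.-tuple K) : exists b : M, bounded (f b) x.
Proof.
have [a Ha] := bounded_exists hK x; have [b Hb] := f_cofinal a.
by exists b => i; apply: PAm_lt_trans (Ha i) Hb.
Qed.

Lemma emb_le (a b : M) : le a b -> le (f a) (f b).
Proof. by case=> [H|->]; [left; rewrite -emb_lt|right]. Qed.

(** The same [delta] and the same [p] from [M] must serve in both structures: only then can
    [f_Delta0] carry facts about [phi] from [M] to [K]. *)
Definition Delta0_on_bounded n (phi : form n) : Prop :=
  forall b : M, exists q (delta : form (n + q)) (p : q.-tuple M),
  [/\ Delta0 delta,
      forall x : n.-tuple M, bounded b x ->
        (sat x phi <-> sat (cat_tuple x p) delta) &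
      forall x : n.-tuple K, bounded (f b) x ->
        (sat x phi <-> sat (cat_tuple x (map_tuple f p)) delta)].

Lemma Delta0_on_bounded_not n (phi : form n) :
  Delta0_on_bounded phi -> Delta0_on_bounded (FNot phi).
Proof.
move=> H b; have [q [delta [p [Hdelta HM HK]]]] := H b.
exists q, (FNot delta), p; split; first exact: Delta0_Not.
  by move=> x Hx /=; rewrite HM.
by move=> x Hx /=; rewrite HK.
Qed.

Lemma equivalent_Delta0_on_bounded n (phi psi : form n) :
  equivalent phi psi -> Delta0_on_bounded psi -> Delta0_on_bounded phi.
Proof.
move=> E H b; have [q [delta [p [Hdelta HM HK]]]] := H b.
by exists q, delta, p; split=> // x Hx; rewrite E (HM, HK).
Qed.

Lemma Delta0_on_bounded_Delta0 n (phi : form n) : Delta0 phi -> Delta0_on_bounded phi.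
Proof.
move=> Hphi b; exists 0, (rename phi (@lshift n 0)), (nil_tuple M).
by split=> [|x _|x _]; [exact: Delta0_rename| |]; rewrite sat_rename retuple_lshift_id.
Qed.

(** The quantifier [exists y] is replaced by [exists y < c], with [c] from strong collection in [M].
    In [K] a witness may exceed [f c], so the existence of a smaller one has to be transferred from
    [M] by a Delta_0 statement. *)
Lemma Delta0_on_bounded_exs m n (psi : form (m + n)) :
  Delta0_on_bounded psi ->
  (forall b : M, exists c : M, forall x : n.-tuple M, bounded b x ->
     (exists y : m.-tuple M, sat (cat_tuple y x) psi) ->
     exists2 y : m.-tuple M, bounded c y & sat (cat_tuple y x) psi) ->
  Delta0_on_bounded (exs psi).
Proof.
move=> Hpsi coll b; have [c0 Hc0] := coll b.
(* Making [c] at least [b] lets the approximation of [psi] at [c] cover both [x] and [y]. *)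
have [c bc c0c] := le_upper_bound hM b c0.
have Hc (x : n.-tuple M) : bounded b x -> sat x (exs psi) ->
    exists2 y : m.-tuple M, bounded c y & sat (cat_tuple y x) psi.
  move=> Hx /sat_exs/(Hc0 x Hx)[y Hy H]; exists y => //.
  exact: bounded_le hM _ _ _ _ Hy c0c.
have [q [delta [p [Hdelta HM HK]]]] := Hpsi c.
exists (1 + q), (exsLt (TVar (rshift n (lshift q ord0))) (insert_params 1 delta)).
exists (cat_tuple [tuple c] p); split.
- by apply: Delta0_exsLt; apply: Delta0_insert_params.
- move=> x Hx; have Hxc := bounded_le hM Hx bc.
  rewrite sat_exsLt eval_param1; split.
    move=> /(Hc x Hx)[y Hy H]; exists y => //; apply/sat_insert_params.
    by apply/HM => //; apply/bounded_cat.
  case=> y Hy /sat_insert_params H; apply/sat_exs; exists y.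
  by apply/HM => //; apply/bounded_cat.
- move=> x Hx; have Hxc := bounded_le hK Hx (emb_le bc).
  rewrite sat_exsLt map_cat_tuple map_tuple1 eval_param1; split; last first.
    case=> y Hy /sat_insert_params H; apply/sat_exs; exists y.
    by apply/HK => //; apply/bounded_cat.
  move=> /sat_exs[y Hy].
  suff: exists2 y, bounded (f c) y & sat (cat_tuple y x) psi.
    case=> {Hy}y Hyc Hy; exists y => //; apply/sat_insert_params.
    by apply/HK => //; apply/bounded_cat.
  (* By cofinality the given witness lies below [f w] for some [w] in [M]; a new approximation [eps]
     of [psi] is taken at this larger bound. *)
  have [w0 Hw0] := cofinal_bounded y; have [w cw w0w] := le_upper_bound hM c w0.
  have Hyw := bounded_le hK Hw0 (emb_le w0w).
  have [q' [eps [p' [Heps HM' HK']]]] := Hpsi w.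
  pose i k := TVar (rshift n (lshift q' (inord k : 'I_3))).
  (* With parameters [b], [w], [c] this says: for every [x < b], an [eps]-witness below [w] yields
     one below [c]. It holds in [M] by the choice of [c]. *)
  pose chi : form (3 + q') := allsLt (TVar (lshift q' ord0))
    (FImp (exsLt (i 1) (insert_params 3 eps)) (exsLt (i 2) (insert_params 3 eps))).
  have chi_Delta0 : Delta0 chi.
    by apply: Delta0_allsLt; apply: Delta0_Imp; apply: Delta0_exsLt;
      apply: Delta0_insert_params.
  have chiP (N : structure) (u v z : N) (r : q'.-tuple N) :
      sat (cat_tuple [tuple u; v; z] r) chi <->
      forall x : n.-tuple N, bounded u x ->
      (exists2 y : m.-tuple N, bounded v y & sat (cat_tuple (cat_tuple y x) r) eps) ->
      (exists2 y : m.-tuple N, bounded z y & sat (cat_tuple (cat_tuple y x) r) eps).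
    have uE : eval (cat_tuple [tuple u; v; z] r) (TVar (lshift q' (@ord0 2))) = u.
      by rewrite /= tnth_lshift tnth0.
    have vE (x' : n.-tuple N) : eval (cat_tuple x' (cat_tuple [tuple u; v; z] r)) (i 1) = v.
      by rewrite /= tnth_param (tnth_nth u) /= inordK.
    have zE (x' : n.-tuple N) : eval (cat_tuple x' (cat_tuple [tuple u; v; z] r)) (i 2) = z.
      by rewrite /= tnth_param (tnth_nth u) /= inordK.
    rewrite sat_allsLt uE; split=> H x' Hx'; have := H x' Hx';
      rewrite [sat _ (FImp _ _)]/= !sat_exsLt vE zE => {}H [y' Hy' Hy'e].
      have [|y2 Hy2 Hy2e] := H; last by exists y2 => //; move/sat_insert_params: Hy2e.
      by exists y' => //; apply/sat_insert_params.
    have [|y2 Hy2 Hy2e] := H; last by exists y2 => //; apply/sat_insert_params.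
    by exists y' => //; move/sat_insert_params: Hy'e.
  have : sat (cat_tuple [tuple b; w; c] p') chi.
    apply/chiP => x' Hx' [y' Hy' Hy'e].
    have Hx'w := bounded_le hM (bounded_le hM Hx' bc) cw.
    have [|y2 Hy2 Hy2e] := Hc x' Hx'.
      by apply/sat_exs; exists y'; apply/HM' => //; apply/bounded_cat.
    exists y2 => //; apply/HM' => //; apply/bounded_cat; split=> //.
    exact: bounded_le hM _ _ _ _ Hy2 cw.
  move/(f_Delta0 chi_Delta0).
  rewrite map_cat_tuple (_ : map_tuple f [tuple b; w; c] = [tuple f b; f w; f c]);
    last exact: val_inj.
  have Hxw := bounded_le hK Hxc (emb_le cw).
  case/chiP/(_ x Hx) => [|y2 Hy2 Hy2e].
    by exists y => //; apply/HK' => //; apply/bounded_cat.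
  exists y2 => //; apply/HK' => //; apply/bounded_cat; split=> //.
  exact: bounded_le hK _ _ _ _ Hy2 (emb_le cw).
Qed.

(** Induction on [j]: each existential block over a Pi_j matrix with [j < k] is handled by strong
    collection for Pi_j. *)
Lemma Delta0_on_bounded_Sigma k : collection (SigmaE k.+1) M ->
  forall j, j <= k -> forall n (phi : form n), SigmaE j phi -> Delta0_on_bounded phi.
Proof.
move=> coll; elim=> [|j IH] jk n phi [chi H E].
  by apply: (equivalent_Delta0_on_bounded E); apply: Delta0_on_bounded_Delta0.
case: H => m [psi [Hpsi chiE]]; rewrite chiE in E.
apply: (equivalent_Delta0_on_bounded E); apply: Delta0_on_bounded_exs.
  (* The Pi_j matrix is treated as the negation of a Sigma_j formula, to which the induction
     hypothesis applies. *)
  apply: (@equivalent_Delta0_on_bounded _ _ (FNot (FNot psi))).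
    by move=> N e /=; rewrite notK.
  apply: Delta0_on_bounded_not; apply: IH; first exact: ltnW.
  by apply: SigmaE_not; apply: Pi_PiE.
exact: (strong_collectionP coll jk (Pi_PiE Hpsi)).
Qed.

Lemma Delta0_on_bounded_Pi k : collection (SigmaE k.+1) M ->
  forall n (phi : form n), PiE k phi -> Delta0_on_bounded phi.
Proof.
move=> coll n phi Hphi; apply: (@equivalent_Delta0_on_bounded _ _ (FNot (FNot phi))).
  by move=> N e /=; rewrite notK.
apply: Delta0_on_bounded_not; apply: (Delta0_on_bounded_Sigma coll (leqnn k)).
exact: SigmaE_not.
Qed.

(** A given [y] in [K] lies below some [f w]; [forall y < w, theta] is equivalent to a Delta_0
    statement true in [M], and this transfers. *)
Lemma cofinal_Pi_succ k : collection (SigmaE k.+1) M ->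
  forall m n (theta : form (m + n)), SigmaE k theta -> forall x : n.-tuple M,
  (forall y : m.-tuple M, sat (cat_tuple y x) theta) ->
  forall y : m.-tuple K, sat (cat_tuple y (map_tuple f x)) theta.
Proof.
move=> coll m n theta Htheta x H y.
have [w1 Hx] := bounded_exists hM x; have [w2 Hy] := cofinal_bounded y.
have [w w1w w2w] := le_upper_bound hM w1 w2.
have [q [delta [p [Hdelta HM HK]]]] := Delta0_on_bounded_Sigma coll (leqnn k) Htheta w.
pose chi : form (n + (1 + q)) :=
  allsLt (TVar (rshift n (lshift q ord0))) (insert_params 1 delta).
have chi_Delta0 : Delta0 chi.
  by apply: Delta0_allsLt; apply: Delta0_insert_params.
have : sat (cat_tuple x (cat_tuple [tuple w] p)) chi.
  apply/sat_allsLt; rewrite eval_param1 => y' Hy'.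
  apply/sat_insert_params/HM => //; apply/bounded_cat; split=> //.
  exact: bounded_le hM _ _ _ _ Hx w1w.
move/(f_Delta0 chi_Delta0)/sat_allsLt.
rewrite !map_cat_tuple map_tuple1 eval_param1 => {}H.
have Hyw := bounded_le hK Hy (emb_le w2w).
apply/HK; last by have /sat_insert_params := H y Hyw.
apply/bounded_cat; split=> //; apply/bounded_map.
exact: bounded_le hM _ _ _ _ Hx w1w.
Qed.

(** For [x] below [f u], collection in [M] bounds the witnesses over all tuples below [u]; with
    [theta] approximated, [forall x < u, exists y < w, theta] becomes Delta_0 and transfers. *)
Lemma cofinal_Pi_succ2 k : collection (SigmaE k.+1) M ->
  forall m n (theta : form (m + n)), PiE k theta ->
  (forall x : n.-tuple M, exists y : m.-tuple M, sat (cat_tuple y x) theta) ->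
  forall x : n.-tuple K, exists y : m.-tuple K, sat (cat_tuple y x) theta.
Proof.
move=> coll m n theta Htheta H x; have [u Hu] := cofinal_bounded x.
have Htheta' : SigmaE k.+1 theta by apply: SigmaE_of_PiE.
have [v0 Hv0] := coll _ _ _ Htheta' H u.
have [w uw v0w] := le_upper_bound hM u v0.
have [q [delta [p [Hdelta HM HK]]]] := Delta0_on_bounded_Pi coll Htheta w.
pose i : 'I_2 := inord 1.
pose chi : form (2 + q) := allsLt (TVar (lshift q ord0))
   (exsLt (TVar (rshift n (lshift q i))) (insert_params 2 delta)).
have chi_Delta0 : Delta0 chi.
  by apply: Delta0_allsLt; apply: Delta0_exsLt; apply: Delta0_insert_params.
have chiP (N : structure) (z v : N) (r : q.-tuple N) :
    sat (cat_tuple [tuple z; v] r) chi <->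
    forall x : n.-tuple N, bounded z x -> exists2 y : m.-tuple N,
      bounded v y & sat (cat_tuple (cat_tuple y x) r) delta.
  have zE : eval (cat_tuple [tuple z; v] r) (TVar (lshift q (@ord0 1))) = z.
    by rewrite /= tnth_lshift.
  have vE (x' : n.-tuple N) :
      eval (cat_tuple x' (cat_tuple [tuple z; v] r)) (TVar (rshift n (lshift q i))) = v.
    by rewrite /= tnth_param (tnth_nth z) /= inordK.
  rewrite sat_allsLt zE; split=> Ha x' Hx'; have := Ha x' Hx';
    rewrite sat_exsLt vE.
    by case=> y Hy /sat_insert_params; exists y.
  by case=> y Hy Hye; exists y => //; apply/sat_insert_params.
have : sat (cat_tuple [tuple u; w] p) chi.
  apply/chiP => x' Hx'; have [y Hy Hye] := Hv0 x' Hx'.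
  have Hyw := bounded_le hM Hy v0w.
  exists y => //; apply/HM => //; apply/bounded_cat; split=> //.
  exact: bounded_le hM _ _ _ _ Hx' uw.
move/(f_Delta0 chi_Delta0).
rewrite map_cat_tuple (_ : map_tuple f [tuple u; w] = [tuple f u; f w]); last exact: val_inj.
case/chiP/(_ x Hu) => y Hy Hye; exists y; apply/HK => //; apply/bounded_cat; split=> //.
exact: bounded_le hK _ _ _ _ Hu (emb_le uw).
Qed.

End CofinalExtension.

Lemma COF_of_collection (M : structure) k : PAminus M ->
  collection (SigmaE k.+1) M -> COF_equiv k.+2 M.
Proof.
move=> hM coll K hK f f0 fcof phi [m [psi [[l [theta [Htheta ->]]] ->]]].
rewrite !sat_exs; split=> -[x Hx].
  exists (map_tuple f x); move/sat_alls: Hx => Hx.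
  have := cofinal_Pi_succ hM hK f0 fcof coll (Sigma_SigmaE Htheta) Hx.
  by rewrite map_cat_tuple (_ : map_tuple f (nil_tuple M) = nil_tuple K);
    [move/sat_alls|exact: val_inj].
(* If no tuple of [M] is a witness, then [M] satisfies [forall x, exists y, ~ theta], which passes
   to [K] and contradicts the witness there. *)
apply: contrapT => /forallNP HM.
have Hn : PiE k (FNot theta) by apply: PiE_not; apply: Sigma_SigmaE.
have [|y /=] := cofinal_Pi_succ2 hM hK f0 fcof coll Hn _ (cat_tuple x (nil_tuple K)).
  move=> x'; have := HM (retuple x' (@lshift m 0)); rewrite sat_alls => /existsNP[y Hy].
  exists y => /=; rewrite (cat_retuple x'); move: Hy; congr (~ sat _ _).
  by congr cat_tuple; congr cat_tuple; apply: eq_from_tnth; case.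
by apply; move/sat_alls: Hx; apply.
Qed.

(** * The initial segment generated by M *)

Section SupStructure.

Context {M N : structure} (f : embedding M N) (hN : PAminus N).
Let S := sup f hN.

Lemma in_sup_le (a b : N) : le a b -> in_sup f b -> in_sup f a.
Proof. by move=> ab [c bc]; exists c; apply: PAm_le_trans bc. Qed.

(** All axioms but subtraction are universal and are inherited from [N]; a difference is at most the
    larger element, so it stays in the initial segment. *)
Lemma PAminus_sup : PAminus S.
Proof.
pose inj := @sup_val_inj M N f hN.
split; try by move=> *; apply: inj; apply hN.
- by move=> x y z; apply: PAm_lt_trans hN _ _ _.
- by move=> x; apply: PAm_lt_irr hN _.
- move=> x y; case: (PAm_lt_total hN (sval x) (sval y)) => [|[/inj|]]; tauto.
- by move=> x y z; apply: PAm_lt_add hN _ _ _.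
- by move=> x y z; apply: PAm_lt_mul hN _ _ _.
- move=> x y /= xy; have [z xz] := PAm_sub hN xy.
  have zS : in_sup f z.
    apply: in_sup_le (svalP y); rewrite -xz -[X in le X _](PAm_addx0 hN) (PAm_addC hN).
    by apply: PAm_le_add => //; [apply: PAm_ge0|right].
  by exists (exist _ z zS); apply: inj.
- exact: PAm_lt01 hN.
- by move=> x /= /(PAm_discrete hN)[|/= x1]; [left|right; apply: inj].
- by move=> x; case: (PAm_ge0 hN (sval x)) => [|/= x0]; [left|right; apply: inj].
Qed.

Lemma eval_sup n (e : n.-tuple S) t :
  eval (map_tuple (fun a : S => sval a) e) t = sval (eval e t).
Proof. exact: (eval_emb (sup_incl f hN)). Qed.

(** An element of [N] below the value of a term at arguments from the initial segment is itself in
    the segment, so bounded quantifiers range over the same elements. *)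
Lemma sup_incl_Delta0 : prec Delta0 (sup_incl f hN).
Proof.
move=> n phi; elim=> {n phi} /=.
- move=> n s t e; rewrite !eval_sup; split=> [->//|]; exact: (@sup_val_inj _ _ f hN).
- by move=> n s t e; rewrite !eval_sup.
- by move=> n phi _ IH e; rewrite IH.
- by move=> n phi psi _ IH _ IH' e; rewrite IH IH'.
- by move=> n phi psi _ IH _ IH' e; rewrite IH IH'.
- by move=> n phi psi _ IH _ IH' e; rewrite IH IH'.
- move=> n t phi _ IH e; split=> H a; rewrite eval_shift.
    rewrite eval_sup => Ha.
    have aS : in_sup f a by exact: in_sup_le (or_introl Ha) (svalP (@eval S _ e t)).
    by have := H (exist _ a aS); rewrite eval_shift => /(_ Ha)/IH; rewrite map_cons_tuple.
  move=> Ha; apply/IH; rewrite map_cons_tuple; apply: H.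
  by rewrite eval_shift eval_sup.
- move=> n t phi _ IH e; split=> -[a]; rewrite eval_shift => -[Ha H].
    exists (sval a); rewrite eval_shift eval_sup; split=> //.
    by move/IH: H; rewrite map_cons_tuple.
  rewrite eval_sup in Ha.
  have aS : in_sup f a by exact: in_sup_le (or_introl Ha) (svalP (@eval S _ e t)).
  exists (exist _ a aS); rewrite eval_shift; split=> //.
  by apply/IH; rewrite map_cons_tuple.
Qed.

Definition sup_base (a : M) : S :=
  exist _ (f a) (ex_intro _ a (or_intror erefl)).

Lemma sup_base_inj : injective sup_base.
Proof. by move=> a b [/emb_inj]. Qed.

Definition sup_base_embedding : embedding M S.
Proof.
apply: (@Embedding M S sup_base sup_base_inj).
- by apply: sup_val_inj; apply: emb_zero.
- by apply: sup_val_inj; apply: emb_one.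
- by move=> a b; apply: sup_val_inj; apply: emb_add.
- by move=> a b; apply: sup_val_inj; apply: emb_mul.
- by move=> a b; apply: emb_lt.
Defined.

Lemma sup_base_cofinal : cofinal sup_base_embedding.
Proof.
(* Membership gives only [a <= f b]; adding one makes the bound strict. *)
move=> [a [b ab]]; exists (add b one).
apply: (le_lt_trans hN ab); rewrite emb_add emb_one; exact: lt_succ.
Qed.

(** [f] factors through the inclusion of the segment in [N], and both of these maps are
    Delta_0-elementary. *)
Lemma sup_base_Delta0 : elementary f -> prec Delta0 sup_base_embedding.
Proof.
move=> fE n phi Hphi a; rewrite (fE n phi I a) (sup_incl_Delta0 Hphi).
by rewrite (_ : map_tuple _ (map_tuple _ a) = map_tuple f a) //; apply: val_inj;
  rewrite /= -map_comp.
Qed.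

End SupStructure.

(** The segment generated by [M] is itself a cofinal Delta_0-elementary extension of [M]. *)
Lemma cof_of_COF (M : structure) k : COF_equiv k M -> cof_equiv k M.
Proof.
move=> H N hN f fE; apply: (H _ (PAminus_sup f hN) (sup_base_embedding f hN)).
  exact: sup_base_Delta0.
exact: sup_base_cofinal.
Qed.

(** That [c] suffices for [b] is expressed by one formula in these two parameters, so it transfers
    along [f]. *)
Lemma strong_collection_elementary (M N : structure) (f : embedding M N) m n
    (psi : form (m + n)) (b c : M) : elementary f ->
  (forall x : n.-tuple M, bounded b x -> (exists y : m.-tuple M, sat (cat_tuple y x) psi) ->
     exists2 y : m.-tuple M, bounded c y & sat (cat_tuple y x) psi) ->
  forall x : n.-tuple N, bounded (f b) x ->
  (exists y : m.-tuple N, sat (cat_tuple y x) psi) ->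
  exists2 y : m.-tuple N, bounded (f c) y & sat (cat_tuple y x) psi.
Proof.
move=> fE H.
pose psi' : form (m + (n + 2)) :=
  rename psi (cat_map (@lshift m (n + 2)) (fun i => rshift m (lshift 2 i))).
pose i : 'I_2 := inord 1.
pose chi : form 2 :=
  allsLt (TVar ord0) (FImp (exs psi') (exsLt (TVar (rshift n i)) psi')).
have chiP (L : structure) (u v : L) : sat [tuple u; v] chi <->
    forall x : n.-tuple L, bounded u x -> (exists y : m.-tuple L, sat (cat_tuple y x) psi) ->
    exists2 y : m.-tuple L, bounded v y & sat (cat_tuple y x) psi.
  have psiP (x : n.-tuple L) (y : m.-tuple L) :
      sat (cat_tuple y (cat_tuple x [tuple u; v])) psi' <-> sat (cat_tuple y x) psi.
    rewrite sat_rename retuple_cat retuple_lshift_id.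
    by rewrite (retuple_rshift _ _ (@lshift n 2)) retuple_lshift_id.
  have vE (x : n.-tuple L) : eval (cat_tuple x [tuple u; v]) (TVar (rshift n i)) = v.
    by rewrite /= tnth_rshift (tnth_nth u) /= inordK.
  rewrite sat_allsLt; split=> Ha x Hx; have := Ha x Hx;
    rewrite [sat _ (FImp _ _)]/= sat_exs sat_exsLt vE => {}Ha [y Hy].
    by have [|z Hz /psiP] := Ha; [exists y; apply/psiP|exists z].
  by have [|z Hz] := Ha; [exists y; apply/psiP|exists z => //; apply/psiP].
have /fE : sat [tuple b; c] chi by apply/chiP.
rewrite (_ : map_tuple f [tuple b; c] = [tuple f b; f c]); last exact: val_inj.
by move=> /(_ I)/chiP.
Qed.

(** Only the descent of an existential block needs work: a bound [c] in [M] for the witnesses is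
    valid in [N] as well, so some witness lies below [f c], that is, in the segment. *)
Lemma end_of_collection (M : structure) k : PAminus M ->
  collection (SigmaE k.+1) M -> end_cond k M.
Proof.
move=> hM coll N hN f fE.
suff H j : j <= k -> prec (Sigma j) (sup_incl f hN) by apply: H.
elim: j => [_|j IH jk n _ [m [psi [Hpsi ->]]] x]; first exact: sup_incl_Delta0.
have {}IH := prec_PiE (IH (ltnW jk)) (Pi_PiE Hpsi).
rewrite !sat_exs; split=> [[y Hy]|Hy].
  by exists (map_tuple (sup_incl f hN) y); rewrite -map_cat_tuple; apply/IH.
have [b Hb] := cofinal_bounded (PAminus_sup f hN) (@sup_base_cofinal M N f hN) x.
have [c Hc] := strong_collectionP coll jk (Pi_PiE Hpsi) b.
have [|y Hyc Hpy] := strong_collection_elementary fE Hc _ Hy.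
  by move=> i; rewrite tnth_map; apply: Hb.
have yS i : in_sup f (tnth y i) by exists c; left.
exists [tuple exist _ (tnth y i) (yS i) : sup f hN | i < m].
apply/IH; rewrite map_cat_tuple; move: Hpy; congr (sat (cat_tuple _ _) _).
by apply: eq_from_tnth => i; rewrite tnth_map tnth_mktuple.
Qed.

Lemma PAminus_elementary (M N : structure) (f : embedding M N) :
  PAminus M -> elementary f -> PAminus N.
Proof.
move=> hM fE.
have tr (phi : form 0) : sat (nil_tuple M) phi -> sat (nil_tuple N) phi.
  by move/(fE 0 phi I); rewrite (_ : map_tuple _ _ = nil_tuple N) //; apply: val_inj.
(* Index 0 is the innermost variable, so within each arity the outermost variable [x] gets the
   highest index. [sat] of each sentence then computes to the matching axiom. *)
pose x1 : term 1 := TVar (@Ordinal 1 0 isT).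
pose x2 : term 2 := TVar (@Ordinal 2 1 isT).
pose y2 : term 2 := TVar (@Ordinal 2 0 isT).
pose x3 : term 3 := TVar (@Ordinal 3 2 isT).
pose y3 : term 3 := TVar (@Ordinal 3 1 isT).
pose z3 : term 3 := TVar (@Ordinal 3 0 isT).
pose all3 phi : form 0 := FAll (FAll (FAll phi)).
split.
- exact: (tr (all3 (FEq (TAdd (TAdd x3 y3) z3) (TAdd x3 (TAdd y3 z3)))) (PAm_addA hM)).
- exact: (tr (FAll (FAll (FEq (TAdd x2 y2) (TAdd y2 x2)))) (PAm_addC hM)).
- exact: (tr (all3 (FEq (TMul (TMul x3 y3) z3) (TMul x3 (TMul y3 z3)))) (PAm_mulA hM)).
- exact: (tr (FAll (FAll (FEq (TMul x2 y2) (TMul y2 x2)))) (PAm_mulC hM)).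
- exact: (tr (all3 (FEq (TMul x3 (TAdd y3 z3)) (TAdd (TMul x3 y3) (TMul x3 z3))))
    (PAm_mulDr hM)).
- exact: (tr (FAll (FEq (TAdd x1 TZero) x1)) (PAm_addx0 hM)).
- exact: (tr (FAll (FEq (TMul x1 TZero) TZero)) (PAm_mulx0 hM)).
- exact: (tr (FAll (FEq (TMul x1 TOne) x1)) (PAm_mulx1 hM)).
- exact: (tr (all3 (FImp (FLt x3 y3) (FImp (FLt y3 z3) (FLt x3 z3)))) (PAm_lt_trans hM)).
- exact: (tr (FAll (FNot (FLt x1 x1))) (PAm_lt_irr hM)).
- exact: (tr (FAll (FAll (FOr (FLt x2 y2) (FOr (FEq x2 y2) (FLt y2 x2)))))
    (PAm_lt_total hM)).
- exact: (tr (all3 (FImp (FLt x3 y3) (FLt (TAdd x3 z3) (TAdd y3 z3)))) (PAm_lt_add hM)).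
- exact: (tr (all3 (FImp (FLt TZero z3) (FImp (FLt x3 y3) (FLt (TMul x3 z3) (TMul y3 z3)))))
    (PAm_lt_mul hM)).
- exact: (tr (FAll (FAll (FImp (FLt x2 y2) (FEx (FEq (TAdd x3 z3) y3))))) (PAm_sub hM)).
- exact: (tr (FLt TZero TOne) (PAm_lt01 hM)).
- exact: (tr (FAll (FImp (FLt TZero x1) (FOr (FLt TOne x1) (FEq TOne x1))))
    (PAm_discrete hM)).
- exact: (tr (FAll (FOr (FLt TZero x1) (FEq TZero x1))) (PAm_ge0 hM)).
Qed.

(** * Ultrapowers *)

Section Ultrapower.

Local Open Scope classical_set_scope.

Context {M : structure} {I : Type} (U : set_system I) {U_ultra : UltraFilter U}.

#[local] Instance ultra_filter : Filter U := filter_filter.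

Lemma ultraT : U setT. Proof. exact: filterT. Qed.

Lemma ultraS (A B : set I) : A `<=` B -> U A -> U B.
Proof. exact: filterS. Qed.

Lemma ultraI (A B : set I) : U A -> U B -> U (A `&` B).
Proof. exact: filterI. Qed.

Lemma ultraS2 (A B C : set I) : (forall i, A i -> B i -> C i) -> U A -> U B -> U C.
Proof. exact: filterS2. Qed.

Lemma ultra_ex (A : set I) : U A -> exists i, A i.
Proof. exact: filter_ex. Qed.

Lemma ultraN (A : set I) : U (~` A) <-> ~ U A.
Proof.
split=> [HC HA|HA].
  by have [i []] := ultra_ex (ultraI HC HA).
by case: (in_ultra_setVsetC A U_ultra).
Qed.

Lemma ultra_iff (A B : set I) : U [set i | A i <-> B i] -> (U A <-> U B).
Proof. by move=> H; split; apply: ultraS2 H => i [AB BA]. Qed.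

Lemma ultra_forall_ord n (A : 'I_n -> set I) :
  (forall j, U (A j)) -> U [set i | forall j, A j i].
Proof. by move=> H; apply: filter_forall. Qed.

Definition choose_in (T : Type) (x0 : T) (P : T -> Prop) : T :=
  if pselect (exists x, P x) is left H then sval (cid H) else x0.

Lemma choose_inP (T : Type) (x0 : T) (P : T -> Prop) (x : T) :
  P x -> P (choose_in x0 P).
Proof.
by move=> Px; rewrite /choose_in; case: pselect => [H|[]]; [case: cid|exists x].
Qed.

(** The quotient modulo [U] is encoded by canonical representatives: functions equal almost
    everywhere define the same predicate, hence receive the same choice. *)
Definition ultra_canon (g : I -> M) : I -> M :=
  choose_in (fun=> zero) (fun h => U [set i | g i = h i]).

Lemma ultra_canonP g : U [set i | g i = ultra_canon g i].
Proof.
apply: (@choose_inP _ (fun=> zero) (fun h => U [set i | g i = h i]) g).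
by apply: ultraS ultraT => i _ /=.
Qed.

Lemma ultra_canon_eq g h : U [set i | g i = h i] -> ultra_canon g = ultra_canon h.
Proof.
move=> gh; rewrite /ultra_canon; congr choose_in; apply/funext => k; apply/propext.
by split; apply: ultraS2 gh => i /= ->.
Qed.

Definition ultra_carrier : Type := {g : I -> M | ultra_canon g = g}.

Definition ultra_class (g : I -> M) : ultra_carrier :=
  exist _ (ultra_canon g) (esym (ultra_canon_eq (ultra_canonP g))).

Definition ultrapower : structure := {|
  carrier := ultra_carrier;
  zero := ultra_class (fun=> zero);
  one := ultra_class (fun=> one);
  add := fun a b => ultra_class (fun i => add (sval a i) (sval b i));
  mul := fun a b => ultra_class (fun i => mul (sval a i) (sval b i));
  lt := fun a b => U [set i | lt (sval a i) (sval b i)]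
|}.

Lemma ultra_classP g : U [set i | sval (ultra_class g) i = g i].
Proof. by apply: ultraS (ultra_canonP g) => i /= <-. Qed.

Lemma ultra_eqP (a b : ultrapower) : a = b <-> U [set i | sval a i = sval b i].
Proof.
split=> [->|]; first by apply: ultraS ultraT => i _ /=.
case: a b => [g Hg] [h Hh] /= /ultra_canon_eq; rewrite Hg Hh => gh.
by case: h / gh Hh => Hh; rewrite (Prop_irrelevance Hg Hh).
Qed.

Definition component (i : I) n (e : n.-tuple ultrapower) : n.-tuple M :=
  map_tuple (fun a : ultrapower => sval a i) e.

Lemma component_cons i n (a : ultrapower) (e : n.-tuple ultrapower) :
  component i (cons_tuple a e) = cons_tuple (sval a i) (component i e).
Proof. exact: val_inj. Qed.

Lemma eval_ultra n (e : n.-tuple ultrapower) t :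
  U [set i | sval (eval e t) i = eval (component i e) t].
Proof.
elim: t => [j|||t Ht u Hu|t Ht u Hu].
- by apply: ultraS ultraT => i _ /=; rewrite tnth_map.
- exact: ultra_classP.
- exact: ultra_classP.
- have Htu := ultra_classP (fun i => add (sval (eval e t) i) (sval (eval e u) i)).
  by apply: ultraS (ultraI Htu (ultraI Ht Hu)) => i /= [-> [-> ->]].
- have Htu := ultra_classP (fun i => mul (sval (eval e t) i) (sval (eval e u) i)).
  by apply: ultraS (ultraI Htu (ultraI Ht Hu)) => i /= [-> [-> ->]].
Qed.

(** Negation, disjunction and implication use that [U] decides every set; at quantifiers a witness
    or counterexample is chosen in each coordinate. *)
Theorem Los n (phi : form n) (e : n.-tuple ultrapower) :
  sat e phi <-> U [set i | sat (component i e) phi].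
Proof.
elim: phi e => {n} /=.
- move=> n s t e; rewrite ultra_eqP; apply: ultra_iff.
  by apply: ultraS2 (eval_ultra e s) (eval_ultra e t) => i /= -> ->.
- move=> n s t e; apply: ultra_iff.
  by apply: ultraS2 (eval_ultra e s) (eval_ultra e t) => i /= -> ->.
- by move=> n phi IH e; rewrite IH -ultraN.
- move=> n phi IH psi IH' e; rewrite IH IH'; split=> [[] /ultraI H /H //|H].
  by split; apply: ultraS H => i [].
- move=> n phi IH psi IH' e; rewrite IH IH'; split.
    by case; apply: ultraS => i; [left|right].
  move=> H; apply: contrapT => /not_orP[/ultraN Hphi /ultraN Hpsi].
  by have [i [[? ?] []]] := ultra_ex (ultraI (ultraI Hphi Hpsi) H).
- move=> n phi IH psi IH' e; rewrite IH IH'; split=> [H|H H']; last first.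
    by apply: ultraS2 H H' => i; apply.
  case: (in_ultra_setVsetC [set i | sat (component i e) phi] U_ultra).
    by move/H; apply: ultraS => i /= ? ?.
  by apply: ultraS => i /= ? ?.
- move=> n phi IH e; split=> [H|H a]; last first.
    by apply/IH; apply: ultraS H => i /(_ (sval a i)); rewrite /= component_cons.
  apply: contrapT => /ultraN Hn.
  (* [g] picks a counterexample in every coordinate that has one, and zero elsewhere. *)
  pose g i := choose_in zero (fun a : M => ~ sat (cons_tuple a (component i e)) phi).
  have /IH Hg := H (ultra_class g).
  have [i [[Hi1 Hi2] Hi3]] := ultra_ex (ultraI (ultraI Hn Hg) (ultra_classP g)).
  case: Hi1 => a; apply: contrapT => Ha.
  move: Hi2; rewrite /= component_cons Hi3.
  exact: (@choose_inP _ zero (fun a : M => ~ sat (cons_tuple a (component i e)) phi) a).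
- move=> n phi IH e; split=> [[a /IH]|H].
    by apply: ultraS => i; rewrite /= component_cons; exists (sval a i).
  pose g i := choose_in zero (fun a : M => sat (cons_tuple a (component i e)) phi).
  exists (ultra_class g); apply/IH.
  apply: ultraS2 H (ultra_classP g) => i [a Ha] Hi.
  rewrite /= component_cons Hi.
  exact: (@choose_inP _ zero (fun a : M => sat (cons_tuple a (component i e)) phi) a).
Qed.

Definition ultra_tuple n (x : I -> n.-tuple M) : n.-tuple ultrapower :=
  [tuple ultra_class (fun i => tnth (x i) j) | j < n].

Lemma ultra_tupleP n (x : I -> n.-tuple M) :
  U [set i | component i (ultra_tuple x) = x i].
Proof.
have H : U [set i | forall j, sval (ultra_class (fun i => tnth (x i) j)) i = tnth (x i) j].
  by apply: ultra_forall_ord => j; apply: ultra_classP.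
by apply: ultraS H => i H; apply: eq_from_tnth => j; rewrite tnth_map tnth_mktuple; apply: H.
Qed.

Lemma diagonal_inj : injective (fun a : M => ultra_class (fun=> a)).
Proof.
move=> a b ab; have Hb := ultra_classP (fun=> b); rewrite -ab in Hb.
have [i [Ha {}Hb]] := ultra_ex (ultraI (ultra_classP (fun=> a)) Hb).
exact: etrans (esym Ha) Hb.
Qed.

Lemma diagonal_op (op : M -> M -> M) (a b : M) :
  ultra_class (fun=> op a b) =
  ultra_class (fun i => op (sval (ultra_class (fun=> a)) i) (sval (ultra_class (fun=> b)) i))
  :> ultrapower.
Proof.
apply/ultra_eqP.
have := ultraI (ultra_classP (fun=> a)) (ultra_classP (fun=> b)).
have := ultraI (ultra_classP (fun=> op a b)) (ultra_classP (fun i =>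
  op (sval (ultra_class (fun=> a)) i) (sval (ultra_class (fun=> b)) i))).
by apply: ultraS2 => i [/= -> ->] [/= -> ->].
Qed.

Lemma diagonal_lt (a b : M) :
  lt a b <-> lt (ultra_class (fun=> a) : ultrapower) (ultra_class (fun=> b) : ultrapower).
Proof.
have H := ultraI (ultra_classP (fun=> a)) (ultra_classP (fun=> b)).
split=> [ab|ab]; first by apply: ultraS H => i /= [-> ->].
by have [i [[/= -> ->]]] := ultra_ex (ultraI H ab).
Qed.

Definition diagonal : embedding M ultrapower :=
  @Embedding M ultrapower (fun a => ultra_class (fun=> a)) diagonal_inj
    erefl erefl (diagonal_op add) (diagonal_op mul) diagonal_lt.

Lemma component_diagonal n (e : n.-tuple M) :
  U [set i | component i (map_tuple diagonal e) = e].
Proof.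
have H : U [set i | forall j, sval (ultra_class (fun=> tnth e j)) i = tnth e j].
  by apply: ultra_forall_ord => j; apply: ultra_classP.
by apply: ultraS H => i H; apply: eq_from_tnth => j; rewrite !tnth_map; apply: H.
Qed.

Lemma diagonal_elementary : elementary diagonal.
Proof.
move=> n phi _ e; rewrite Los; split=> H.
  by apply: ultraS (component_diagonal e) => i /= ->.
have [i [/= Hi {}H]] := ultra_ex (ultraI (component_diagonal e) H).
by rewrite -Hi.
Qed.

End Ultrapower.

(** The ultrapower is indexed by [M] itself, with [U] extending the filter of final segments. The
    tuple [e] is the class of the sequence [x], so it satisfies whatever holds of [x c] for all
    large [c]. *)
Lemma tail_realized (M : structure) (hM : PAminus M) n (x : M -> n.-tuple M) :
  exists (N : structure) (f : embedding M N) (e : n.-tuple N), elementary f /\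
  forall q (phi : form (n + q)) (p : q.-tuple M) (a : M),
  (forall c, le a c -> sat (cat_tuple (x c) p) phi) ->
  sat (cat_tuple e (map_tuple f p)) phi.
Proof.
pose F := filter_from (@classical_sets.setT M) (fun a c : M => le a c).
have F_proper : ProperFilter F.
  apply: filter_from_proper => [|a _]; last by exists a; right.
  apply: filter_from_filter => [|a b _ _]; first by exists zero.
  have [c ac bc] := le_upper_bound hM a b.
  by exists c => // d cd; split; apply: PAm_le_trans cd.
have [U [U_ultra FU]] := ultraFilterLemma F_proper.
exists (@ultrapower M M U U_ultra), (@diagonal M M U U_ultra), (ultra_tuple x); split.
  exact: diagonal_elementary.
move=> q phi p a H; apply/Los.
have Ua : U (fun c : M => le a c) by apply: FU; exists a.
have Ue := @ultra_tupleP M M U U_ultra n x.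
have Up := @component_diagonal M M U U_ultra q p.
have U_filter : Filter U := @filter_filter _ _ (@ultra_proper _ U U_ultra).
apply: filterS (@filterI _ U U_filter _ _ Ua (@filterI _ U U_filter _ _ Ue Up)) => c.
move=> [ac [/= ec pc]].
by rewrite /component map_cat_tuple -!/(component _ _) ec pc; apply: H.
Qed.

(** * Equivalence of the conditions *)

(** A limit [e] of tuples lacking witnesses below larger and larger [c] has no witness in the
    segment at all, which yields a Sigma_{k+2} sentence to pull back to [M]. *)
Lemma collection_of_end_cof_Pi (M : structure) k : PAminus M ->
  end_cond k M -> cof_equiv k.+2 M -> collection (PiE k) M.
Proof.
move=> hM hend hcof m n psi Hpsi Hxy b; apply: contrapT => /forallNP Hno.
have {}Hno c : exists x : n.-tuple M, bounded b x /\
    forall y : m.-tuple M, bounded c y -> ~ sat (cat_tuple y x) psi.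
  have /existsNP[x /not_implyP[Hx Hn]] := Hno c.
  by exists x; split=> // y Hy Hxy'; apply: Hn; exists y.
have [x Hx] := choice Hno.
have [N [f [e [fE He]]]] := tail_realized hM x.
have hN := PAminus_elementary hM fE; pose S := sup f hN.
(* Every [x c] is below [b], so the tail may start anywhere; the last argument [b] is an arbitrary
   choice. *)
have eb : bounded (f b) e.
  move=> i; have := He _ (FLt (TVar (lshift 1 i)) (TVar (rshift n ord0))) [tuple b] b.
  rewrite map_tuple1 /= tnth_lshift tnth_rshift; apply=> c _.
  by rewrite tnth_lshift tnth_rshift; apply: (proj1 (Hx c)).
have eS i : in_sup f (tnth e i) by exists b; left.
pose e' : n.-tuple S := [tuple exist _ (tnth e i) (eS i) | i < n].
have e'E : map_tuple (sup_incl f hN) e' = e.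
  by apply: eq_from_tnth => i; rewrite tnth_map tnth_mktuple.
have no_witness (y : m.-tuple S) : ~ sat (cat_tuple y e') psi.
  rewrite (prec_PiE (hend N hN f fE) Hpsi) map_cat_tuple e'E.
  have [d Hd] := cofinal_bounded (PAminus_sup f hN) (@sup_base_cofinal M N f hN) y.
  pose psi' : form (m + (n + 1)) :=
    rename psi (cat_map (@lshift m (n + 1)) (fun i => rshift m (lshift 1 i))).
  have psiP (L : structure) (u : L) (x' : n.-tuple L) (y' : m.-tuple L) :
      sat (cat_tuple y' (cat_tuple x' [tuple u])) psi' <-> sat (cat_tuple y' x') psi.
    rewrite sat_rename retuple_cat retuple_lshift_id.
    by rewrite (retuple_rshift _ _ (@lshift n 1)) retuple_lshift_id.
  (* For [c] at least [d], [x c] has no witness below [d]; hence [e] has none below [f d], which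
     bounds [y]. *)
  have : sat (cat_tuple e [tuple f d]) (allsLt (TVar (rshift n ord0)) (FNot psi')).
    rewrite -map_tuple1; apply: (He _ _ _ d) => c dc; apply/sat_allsLt => y'.
    rewrite [eval _ _]tnth_rshift => Hy' /psiP.
    by apply: (proj2 (Hx c)); apply: bounded_le dc.
  move=> /sat_allsLt H Hy; apply: (H (map_tuple (sup_incl f hN) y)); last exact/psiP.
  by move=> i; rewrite [eval _ _]tnth_rshift tnth_map; apply: Hd.
pose psi0 : form (m + (n + 0)) := rename psi
  (cat_map (@lshift m (n + 0)) (fun i => rshift m (lshift 0 i))).
have psi0P (L : structure) (x' : n.-tuple L) (y' : m.-tuple L) :
    sat (cat_tuple y' (cat_tuple x' (nil_tuple L))) psi0 <-> sat (cat_tuple y' x') psi.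
  rewrite sat_rename retuple_cat retuple_lshift_id.
  by rewrite (retuple_rshift _ _ (@lshift n 0)) retuple_lshift_id.
(* The sentence [exists x, forall y, ~ psi] holds in the segment through [e']; by the cofinality
   condition it holds in [M], against [Hxy]. *)
have Hsigma : SigmaE k.+2 (exs (alls (FNot psi0)) : form 0).
  by apply: SigmaE_exs; apply: PiE_alls; apply: SigmaE_not; apply: PiE_rename.
have /(equiv_SigmaE (hcof N hN f fE) Hsigma)/sat_exs[x' /sat_alls Hx'] :
    sat (nil_tuple S) (exs (alls (FNot psi0))).
  by apply/sat_exs; exists e'; apply/sat_alls => y /psi0P; apply: no_witness.
by have [y Hy] := Hxy x'; apply: (Hx' y); apply/psi0P.
Qed.

(** The leading existential block joins the witnesses; once the joint tuple is bounded, its [y] part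
    is kept. *)
Lemma collection_Sigma_succ (M : structure) k :
  collection (PiE k) M -> collection (SigmaE k.+1) M.
Proof.
move=> coll m n phi [_ [p [psi [Hpsi ->]]] E] Hxy b.
pose s := cat_map (fun i => lshift n (@lshift p m i))
  (cat_map (fun i => lshift n (@rshift p m i)) (@rshift (p + m) n)).
have psiP (w : p.-tuple M) (y : m.-tuple M) (x : n.-tuple M) :
    sat (cat_tuple (cat_tuple w y) x) (rename psi s) <->
    sat (cat_tuple w (cat_tuple y x)) psi.
  rewrite sat_rename !retuple_cat (retuple_lshift _ _ (@lshift p m)).
  rewrite (retuple_lshift _ _ (@rshift p m)) retuple_lshift_id.
  by rewrite !retuple_rshift_id.
have [|c Hc] := coll _ _ _ (PiE_rename s (Pi_PiE Hpsi)) _ b.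
  move=> x; have [y /E/sat_exs[w Hw]] := Hxy x.
  by exists (cat_tuple w y); apply/psiP.
exists c => x /Hc[wy]; rewrite (cat_retuple wy).
move=> /bounded_cat[_ Hy] /psiP H; exists (retuple wy (@rshift p m)) => //.
by apply/E/sat_exs; exists (retuple wy (@lshift p m)).
Qed.

Theorem theorem5p4 (M : structure) (hM : PAminus M) (n : nat) :
  (Coll_w_d (Sigma n.+1) M <-> Coll_w_minus (Sigma n.+1) M) /\
  (Coll_w_minus (Sigma n.+1) M <-> end_cond n M /\ COF_equiv n.+2 M) /\
  (end_cond n M /\ COF_equiv n.+2 M <-> end_cond n M /\ cof_equiv n.+2 M).
Proof.
(* The last three conditions are proved equivalent in a cycle through [collection]. *)
have to_COF : collection (SigmaE n.+1) M -> end_cond n M /\ COF_equiv n.+2 M.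
  by move=> H; split; [apply: end_of_collection|apply: COF_of_collection].
have of_cof : end_cond n M /\ cof_equiv n.+2 M -> collection (SigmaE n.+1) M.
  by move=> [Hend Hcof]; apply: collection_Sigma_succ; apply: collection_of_end_cof_Pi.
have to_cof : end_cond n M /\ COF_equiv n.+2 M -> end_cond n M /\ cof_equiv n.+2 M.
  by move=> [Hend HCOF]; split=> //; apply: cof_of_COF.
split; first exact: Coll_w_d_minus.
split; last by split=> [/to_cof|/of_cof/to_COF].
by rewrite (Coll_w_minusP _ hM); split=> [/to_COF|/to_cof/of_cof].
Qed.
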